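(* Let $M$ be a compact Riemannian manifold, let $X$ be a flow (i.e. a $C^1$ vector field) on $M$, let $\Lambda_+\subset M$ be a positively sectional-hyperbolic set of $X$ and let $\Lambda_-\subset M$ be a negatively sectional-hyperbolic set of $X$. Then $\Lambda_+\cap\Lambda_-$ is a disjoint union $H\sqcup S\sqcup R$ of a (possibly empty) hyperbolic set $H$ of $X$ containing no singularities of $X$, a (possibly empty) finite set $S$ of singularities of $X$, and a (possibly empty) set $R$ of regular points (points that are not singularities of $X$) such that $\alpha(x)\subset H\cup S$ and $\omega(x)\subset H\cup S$ for every $x\in R$.
   Context: $M$ has Riemannian metric $\langle\cdot,\cdot\rangle$ and induced norm $\|\cdot\|$. A flow is a $C^1$ vector field $X$ on $M$, with induced flow $X_t$; $-X$ is the reversed flow. Singularities of $X$ are its zeroes. A set $\Lambda$ is invariant if $X_t(\Lambda)=\Lambda$ for all $t\in\mathbb{R}$. $\omega(x)$ is the set of $y\in M$ with $y=\lim_n X_{t_n}(x)$ for some $t_n\to\infty$; $\alpha(x)$ is the $\omega$-limit set of $x$ for $-X$. Hyperbolic: a compact invariant set $\Lambda$ is hyperbolic if there are a continuous $DX_t$-invariant splitting $T_\Lambda M=E^s\oplus E^X\oplus E^u$ and $K,\lambda>0$ such that (1) $E^s$ is contracting: $\|DX_t(x)v\|\le Ke^{-\lambda t}\|v\|$ for all $x\in\Lambda$, $v\in E^s_x$, $t\ge0$; (2) $E^X_x$ is the subspace of $T_xM$ generated by $X(x)$; (3) $E^u$ is expanding: $\|DX_t(x)v\|\ge K^{-1}e^{\lambda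 t}\|v\|$ for all $x\in\Lambda$, $v\in E^u_x$, $t\ge0$. Subbundles may be zero. A singularity $\sigma$ is hyperbolic if $\{\sigma\}$ is a hyperbolic set. Dominated splitting: a compact invariant set $\Lambda$ has a dominated splitting with respect to the tangent flow if there are a $DX_t$-invariant splitting into subbundles $T_\Lambda M=E\oplus F$ and $K,\lambda>0$ with $\|DX_t(x)e\|\cdot\|f\|\le Ke^{-\lambda t}\|DX_t(x)f\|\cdot\|e\|$ for all $x\in\Lambda$, $t\ge0$, $(e,f)\in E_x\times F_x$ (either subbundle may be zero). It is a partially hyperbolic splitting if moreover $E$ is contracting. For $u,v\in T_pM$ let $\|u,v\|=\sqrt{\langle u,u\rangle\langle v,v\rangle-\langle u,v\rangle^2}$ (area of the parallelogram spanned by $u,v$). $F$ is sectionally expanding if there are $K,\lambda>0$ with $\|DX_t(x)u,DX_t(x)v\|\ge K^{-1}e^{\lambda t}\|u,v\|$ for all $x\in\Lambda$, $u,v\in F_x$, $t\ge0$. A sectional-hyperbolic splitting for $X$ over $\Lambda$ is a partially hyperbolic splitting $T_\Lambda M=E\oplus F$ with $F$ sectionally expanding. A compact invariant set $\Lambda$ is sectional-hyperbolic for $X$ if every singularity of $X$ in $\Lambda$ is hyperbolic and there is a sectional-hyperbolic splitting for $X$ over $\Lambda$. It is positively (resp. negatively) sectional-hyperbolic if it is sectional-hyperbolic for $X$ (resp. for $-X$). *)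

(* Defs.v *)
From mathcomp Require Import all_boot all_order all_algebra.
From mathcomp Require Import all_classical all_reals all_analysis.
Import Order.TTheory GRing.Theory Num.Theory numFieldNormedType.Exports.

Set Implicit Arguments.
Unset Strict Implicit.
Unset Printing Implicit Defensive.

Local Open Scope classical_set_scope.
Local Open Scope ring_scope.

(* [f] is of class C^k on [U], where [U] is meant to be open; [V] is meant to
   be finite-dimensional, so that f is C^(k+1) iff it is differentiable and
   all its directional derivatives are C^k. *)
Fixpoint Ck (R : realType) (V W : normedModType R) (k : nat) (U : set V)
    (f : V -> W) : Prop :=
  match k with
  | 0%N => forall y, U y -> {for y, continuous f}
  | k'.+1 => (forall y, U y -> differentiable f y) /\
             (forall v, Ck k' U (fun y => 'd f y v))
  end.

Definition smooth (R : realType) (V W : normedModType R) (U : set V)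
    (f : V -> W) : Prop :=
  forall k, Ck k U f.

(* Only the values of [fwd] on [dom] and of [bwd] on [img] are meaningful. *)
Record chart (R : realType) (n : nat) (M : topologicalType) := Chart {
  dom : set M;
  img : set 'rV[R]_n;
  fwd : M -> 'rV[R]_n;
  bwd : 'rV[R]_n -> M;
  dom_open : open dom;
  img_open : open img;
  fwd_img : forall p, dom p -> img (fwd p);
  bwd_dom : forall y, img y -> dom (bwd y);
  fwdK : forall p, dom p -> bwd (fwd p) = p;
  bwdK : forall y, img y -> fwd (bwd y) = y;
  fwd_continuous : forall p, dom p -> {for p, continuous fwd};
  bwd_continuous : forall y, img y -> {for y, continuous bwd} }.

(* A smooth, Hausdorff manifold without boundary, of pure dimension [n].
   Second countability is not required: it follows from compactness for the
   compact manifolds to which these definitions are applied.  [chart_at p] is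
   a preferred chart around [p]; it is used only to represent tangent vectors
   at [p] by coordinate vectors. *)
Record manifold (R : realType) (n : nat) := Manifold {
  mspace :> topologicalType;
  mhausdorff : hausdorff_space mspace;
  atlas : set (chart R n mspace);
  atlas_smooth : forall c c', atlas c -> atlas c' ->
    smooth [set y | img c y /\ dom c' (bwd c y)] (fwd c' \o bwd c);
  chart_at : mspace -> chart R n mspace;
  chart_at_atlas : forall p, atlas (chart_at p);
  chart_at_dom : forall p, dom (chart_at p) p }.

(* The tangent space T_pM is 'rV[R]_n, a vector standing for the tangent
   vector at p with these coordinates in the chart [chart_at p].  Accordingly
   a (set-theoretic) vector field on M is a map M -> 'rV[R]_n. *)

(* Coordinates, in a chart c around p, of a tangent vector at p. *)
Definition tcoord (R : realType) (n : nat) (M : manifold R n)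
    (c : chart R n M) (p : M) : 'rV[R]_n -> 'rV[R]_n :=
  'd (fwd c \o bwd (chart_at p)) (fwd (chart_at p) p).

(* The inverse operation. *)
Definition tvec (R : realType) (n : nat) (M : manifold R n)
    (c : chart R n M) (p : M) : 'rV[R]_n -> 'rV[R]_n :=
  'd (fwd (chart_at p) \o bwd c) (fwd c p).

(* The tangent map Df(p) : T_pM -> T_(f p)M. *)
Definition tmap (R : realType) (n : nat) (M : manifold R n)
    (f : M -> M) (p : M) : 'rV[R]_n -> 'rV[R]_n :=
  'd (fwd (chart_at (f p)) \o f \o bwd (chart_at p)) (fwd (chart_at p) p).

Definition inner (R : realType) (n : nat) (M : manifold R n)
    (g : M -> 'M[R]_n) (p : M) (u v : 'rV[R]_n) : R :=
  (u *m g p *m v^T) 0 0.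

(* Smoothness: the functions g_ij = <d/dx_i, d/dx_j> are smooth in charts. *)
Record riemannian (R : realType) (n : nat) (M : manifold R n) := Riemannian {
  metric :> M -> 'M[R]_n;
  metric_sym : forall p, (metric p)^T = metric p;
  metric_pos : forall p v, v != 0 -> 0 < inner metric p v v;
  metric_smooth : forall (c : chart R n M) (i j : 'I_n), atlas c ->
    smooth (img c) (fun y : 'rV[R]_n =>
      inner metric (bwd c y) (tvec c (bwd c y) (delta_mx 0 i))
                             (tvec c (bwd c y) (delta_mx 0 j)) : R^o) }.

Definition tnorm (R : realType) (n : nat) (M : manifold R n)
    (g : riemannian M) (p : M) (v : 'rV[R]_n) : R :=
  Num.sqrt (inner g p v v).

Definition tarea (R : realType) (n : nat) (M : manifold R n)
    (g : riemannian M) (p : M) (u v : 'rV[R]_n) : R :=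
  Num.sqrt (inner g p u u * inner g p v v - inner g p u v ^+ 2).

Definition C1_field (R : realType) (n : nat) (M : manifold R n)
    (X : M -> 'rV[R]_n) : Prop :=
  forall c : chart R n M, atlas c ->
    Ck 1 (img c) (fun y => tcoord c (bwd c y) (X (bwd c y))).

(* [phi] is the flow induced by [X]: the C^1 action of the additive group of
   the reals on M whose infinitesimal generator is [X]. *)
Record is_flow (R : realType) (n : nat) (M : manifold R n)
    (X : M -> 'rV[R]_n) (phi : R -> M -> M) : Prop := IsFlow {
  flow_continuous : continuous (fun z : R * M => phi z.1 z.2);
  flow_C1 : forall c c' : chart R n M, atlas c -> atlas c' ->
    Ck 1 [set z : R * 'rV[R]_n | img c z.2 /\ dom c' (phi z.1 (bwd c z.2))]
         (fun z : R * 'rV[R]_n => fwd c' (phi z.1 (bwd c z.2)));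
  flow0 : forall p, phi 0 p = p;
  flowD : forall s t p, phi (s + t) p = phi s (phi t p);
  flow_generator : forall p,
    is_derive (0 : R) 1 (fun t => fwd (chart_at p) (phi t p)) (X p) }.

Definition rev_field (R : realType) (n : nat) (M : manifold R n)
    (X : M -> 'rV[R]_n) : M -> 'rV[R]_n := fun p => - X p.

(* The flow of -X, where [phi] is the flow of X. *)
Definition rev_flow (R : realType) (n : nat) (M : manifold R n)
    (phi : R -> M -> M) : R -> M -> M := fun t => phi (- t).

Definition sing (R : realType) (n : nat) (M : manifold R n)
    (X : M -> 'rV[R]_n) : set M := [set p | X p = 0].

Definition invariant (R : realType) (n : nat) (M : manifold R n)
    (phi : R -> M -> M) (L : set M) : Prop :=
  forall t, phi t @` L = L.

Definition omega_limit (R : realType) (n : nat) (M : manifold R n)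
    (phi : R -> M -> M) (x : M) : set M :=
  [set y | exists t : nat -> R,
     t k @[k --> \oo] --> +oo /\ phi (t k) x @[k --> \oo] --> y].

Definition alpha_limit (R : realType) (n : nat) (M : manifold R n)
    (phi : R -> M -> M) (x : M) : set M :=
  omega_limit (rev_flow phi) x.

Definition continuous_field_on (R : realType) (n : nat) (M : manifold R n)
    (A : set M) (v : M -> 'rV[R]_n) : Prop :=
  forall c : chart R n M, atlas c ->
    {within A `&` dom c, continuous (fun p => tcoord c p (v p))}.

(* A subbundle is a continuous one: near each point of L it is spanned by a
   continuous frame (in particular its rank is locally constant on L). *)
Definition subbundle (R : realType) (n : nat) (M : manifold R n)
    (L : set M) (E : M -> {vspace 'rV[R]_n}) : Prop :=
  forall x, L x -> exists (U : set M) (d : nat) (e : 'I_d -> M -> 'rV[R]_n),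
    [/\ nbhs x U,
        forall i, continuous_field_on (L `&` U) (e i) &
        forall y, L y -> U y -> basis_of (E y) [tuple e i y | i < d]].

Definition flow_invariant (R : realType) (n : nat) (M : manifold R n)
    (phi : R -> M -> M) (L : set M) (E : M -> {vspace 'rV[R]_n}) : Prop :=
  forall t x, L x -> (linfun (tmap (phi t) x) @: E x)%VS = E (phi t x).

Definition contracting_with (R : realType) (n : nat) (M : manifold R n)
    (g : riemannian M) (phi : R -> M -> M) (L : set M)
    (E : M -> {vspace 'rV[R]_n}) (K lambda : R) : Prop :=
  forall x v t, L x -> v \in E x -> 0 <= t ->
    tnorm g (phi t x) (tmap (phi t) x v)
      <= K * expR (- (lambda * t)) * tnorm g x v.

Definition expanding_with (R : realType) (n : nat) (M : manifold R n)
    (g : riemannian M) (phi : R -> M -> M) (L : set M)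
    (E : M -> {vspace 'rV[R]_n}) (K lambda : R) : Prop :=
  forall x v t, L x -> v \in E x -> 0 <= t ->
    tnorm g (phi t x) (tmap (phi t) x v)
      >= K^-1 * expR (lambda * t) * tnorm g x v.

Definition contracting (R : realType) (n : nat) (M : manifold R n)
    (g : riemannian M) (phi : R -> M -> M) (L : set M)
    (E : M -> {vspace 'rV[R]_n}) : Prop :=
  exists K lambda : R,
    [/\ 0 < K, 0 < lambda & contracting_with g phi L E K lambda].

Definition sectionally_expanding (R : realType) (n : nat) (M : manifold R n)
    (g : riemannian M) (phi : R -> M -> M) (L : set M)
    (F : M -> {vspace 'rV[R]_n}) : Prop :=
  exists K lambda : R, [/\ 0 < K, 0 < lambda &
    forall x u v t, L x -> u \in F x -> v \in F x -> 0 <= t ->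
      tarea g (phi t x) (tmap (phi t) x u) (tmap (phi t) x v)
        >= K^-1 * expR (lambda * t) * tarea g x u v].

Definition hyperbolic (R : realType) (n : nat) (M : manifold R n)
    (g : riemannian M) (X : M -> 'rV[R]_n) (phi : R -> M -> M)
    (L : set M) : Prop :=
  [/\ compact L, invariant phi L &
    exists (Es EX Eu : M -> {vspace 'rV[R]_n}) (K lambda : R),
      [/\ [/\ subbundle L Es, subbundle L EX & subbundle L Eu],
          [/\ flow_invariant phi L Es, flow_invariant phi L EX
            & flow_invariant phi L Eu],
          forall x, L x -> (Es x + EX x + Eu x)%VS = fullv /\
                           directv (Es x + EX x + Eu x),
          0 < K /\ 0 < lambda &
          [/\ contracting_with g phi L Es K lambda,
              forall x, L x -> EX x = <[X x]>%VS &
              expanding_with g phi L Eu K lambda]]].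

Definition dominated_splitting (R : realType) (n : nat) (M : manifold R n)
    (g : riemannian M) (phi : R -> M -> M) (L : set M)
    (E F : M -> {vspace 'rV[R]_n}) : Prop :=
  [/\ subbundle L E /\ subbundle L F,
      flow_invariant phi L E /\ flow_invariant phi L F,
      forall x, L x -> (E x + F x)%VS = fullv /\ directv (E x + F x) &
      exists K lambda : R, [/\ 0 < K, 0 < lambda &
        forall x t e f, L x -> 0 <= t -> e \in E x -> f \in F x ->
          tnorm g (phi t x) (tmap (phi t) x e) * tnorm g x f
            <= K * expR (- (lambda * t))
               * tnorm g (phi t x) (tmap (phi t) x f) * tnorm g x e]].

Definition partially_hyperbolic_splitting (R : realType) (n : nat)
    (M : manifold R n) (g : riemannian M) (phi : R -> M -> M) (L : set M)
    (E F : M -> {vspace 'rV[R]_n}) : Prop :=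
  dominated_splitting g phi L E F /\ contracting g phi L E.

Definition sectional_hyperbolic_splitting (R : realType) (n : nat)
    (M : manifold R n) (g : riemannian M) (phi : R -> M -> M) (L : set M)
    (E F : M -> {vspace 'rV[R]_n}) : Prop :=
  partially_hyperbolic_splitting g phi L E F /\
  sectionally_expanding g phi L F.

Definition sectional_hyperbolic (R : realType) (n : nat) (M : manifold R n)
    (g : riemannian M) (X : M -> 'rV[R]_n) (phi : R -> M -> M)
    (L : set M) : Prop :=
  [/\ compact L, invariant phi L,
      forall s, L s -> sing X s -> hyperbolic g X phi [set s] &
      exists E F, sectional_hyperbolic_splitting g phi L E F].

Definition positively_sectional_hyperbolic (R : realType) (n : nat)
    (M : manifold R n) (g : riemannian M) (X : M -> 'rV[R]_n)
    (phi : R -> M -> M) (L : set M) : Prop :=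
  sectional_hyperbolic g X phi L.

Definition negatively_sectional_hyperbolic (R : realType) (n : nat)
    (M : manifold R n) (g : riemannian M) (X : M -> 'rV[R]_n)
    (phi : R -> M -> M) (L : set M) : Prop :=
  sectional_hyperbolic g (rev_field X) (rev_flow phi) L.

(* Main.v *)
From HB Require Import structures.
Require Import Defs.
From mathcomp Require Import all_boot all_order all_algebra.
From mathcomp Require Import all_classical all_reals all_analysis.
From mathcomp Require Import zify ring lra.
Import Order.TTheory GRing.Theory Num.Theory numFieldNormedType.Exports.

(** Why the theorem holds.  Put L = Lp `&` Lm, with splittings E1 + F1 over Lp
    for the flow and E2 + F2 over Lm for the reversed flow: E1 contracts
    forwards, E2 contracts backwards and so expands forwards, areas in F1 grow
    forwards and areas in F2 grow backwards.

    Linear algebra at a point x of L.  The field is bounded, so X x cannot have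
    an E1-component (it would blow up backwards): X x lies in F1 x, and likewise
    in F2 x.  Areas in F1 x `&` F2 x would both grow and shrink, so this
    intersection is at most a line; if X x <> 0 it is the line of X x.
    Counting dimensions, the direct sum E1 x + <X x> + E2 x is then the whole
    tangent space ([regular_splitting]).  All constants being uniform, every
    compact invariant subset of L without singularities is hyperbolic
    ([hyperbolic_regular_part]).

    Near a singularity s of L.  Orbits of L move along F1 and F2, so the mean
    value theorem shows that the displacement phi_tau p - p is almost in the
    line V = F1 s `&` F2 s for p in L near s.  To first order it is (D - 1) h,
    where h is the position of p relative to s and D the derivative of phi_tau
    at s.  As s is hyperbolic, D - 1 is injective, and it preserves F1 s and
    F2 s; hence h itself is almost in V ([disp_close_to_center]).  The invariant
    line V is either contracted or expanded by the flow, so some time map,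
    forwards or backwards, halves the distance of the points of L to s
    ([center_contraction]).  Thus s attracts its neighbours in L, for the flow
    or for the reversed flow ([singularity_attracts]).

    Topology.  The basins of these attracting and repelling singularities are
    invariant and open in L; in particular the singularities of L are isolated,
    hence finite in number.  H is what is left of L outside all the basins: it
    is compact and invariant.  If the omega-limit set of a regular point x meets
    the basin of an attracting singularity, x converges to that singularity; it
    cannot meet the basin of a repelling one, since x would have started
    arbitrarily close to it and thus be equal to it.  So limit sets lie in H
    and the singularities ([omega_remainder]).  *)

Set Implicit Arguments.
Unset Strict Implicit.
Unset Printing Implicit Defensive.

Local Open Scope classical_set_scope.
Local Open Scope ring_scope.

(** * Topological dynamics: attracted fixed points and the remainder set *)

Lemma cvg_near {T U : Type} (F : set_system T) (f : T -> U) (G : set_system U)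
  (A : set U) : f y @[y --> F] --> G -> G A -> \forall y \near F, A (f y).
Proof. by move=> fG /fG. Qed.

(** An infinite S would make the sets with cofinite trace on S a proper filter
    containing L; none of its cluster points in L has a neighbourhood with
    finite trace on S. *)
Lemma locally_finite_compact (T : topologicalType) (L S : set T) :
  compact L -> S `<=` L ->
  (forall x, L x -> exists2 U, nbhs x U & finite_set (S `&` U)) -> finite_set S.
Proof.
move=> cL SL lf; apply: contrapT => infS.
pose F : set_system T := [set A | finite_set (S `\` A)].
have FF : ProperFilter F.
  split; first by rewrite /F /= setD0.
  split; rewrite /F /=.
  - by rewrite setDT; exact: finite_set0.
  - by move=> A B fA fB; rewrite /= setDE setCI setIUr finite_setU -!setDE.
  - by move=> A B AB; apply: sub_finite_set => x [Sx nBx]; split => // /AB.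
have FL : F L by rewrite /F /= (_ : S `\` L = set0)// -subset0 => x [/SL].
have [x [Lx clx]] := cL F FF FL.
have [U xU fU] := lf x Lx.
have FSU : F (S `\` U).
  rewrite /F /=; apply: sub_finite_set fU => y [Sy h]; split => //.
  by apply: contrapT => nU; apply: h.
by have [y [[_ nUy] Uy]] := clx _ _ FSU xU.
Qed.

Lemma hausdorff_nbhs_eq (T : topologicalType) (p q : T) : hausdorff_space T ->
  (forall U, nbhs p U -> U q) -> p = q.
Proof.
move=> hT h; apply: hT => A B pA qB; exists q; split; first exact: h.
exact: nbhs_singleton.
Qed.

Record flow_action (R : realType) (T : topologicalType) (phi : R -> T -> T) : Prop :=
  FlowAction {
    action_continuous : continuous (fun z : R * T => phi z.1 z.2);
    action0 : forall p, phi 0 p = p;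
    actionD : forall s t p, phi (s + t) p = phi s (phi t p) }.

(** Asymptotic stability of s for the dynamics restricted to L. Lyapunov
    stability, the first half, is what keeps orbits from leaving a repelling
    singularity and coming back to it. *)
Definition attracts (R : realType) (T : topologicalType) (phi : R -> T -> T)
    (L : set T) (s : T) : Prop :=
  (forall U, nbhs s U ->
     \forall x \near s, L x -> forall t, 0 <= t -> U (phi t x)) /\
  (\forall x \near s, L x -> phi t x @[t --> +oo] --> s).

Definition basin (R : realType) (T : topologicalType) (phi : R -> T -> T)
    (L : set T) (s : T) : set T :=
  [set x | L x /\ phi t x @[t --> +oo] --> s].

(** [omega_limit] for a flow on a topological space, so that this part does
    not depend on a manifold structure; likewise [backward] is [rev_flow]. *)
Definition omega_set (R : realType) (T : topologicalType) (phi : R -> T -> T)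
    (x : T) : set T :=
  [set y | exists t : nat -> R,
     t k @[k --> \oo] --> +oo /\ phi (t k) x @[k --> \oo] --> y].

Section Basins.
Context {R : realType} {T : topologicalType} (hT : hausdorff_space T).
Implicit Types (phi : R -> T -> T) (L S : set T) (s x y : T).

Definition backward phi : R -> T -> T := fun t => phi (- t).

Lemma backwardK phi : backward (backward phi) = phi.
Proof. by apply/funext => t; rewrite /backward opprK. Qed.

Lemma action_backward phi : flow_action phi -> flow_action (backward phi).
Proof.
move=> [fc f0 fD]; split; rewrite /backward.
- move=> [t p]; have h : (- z.1, z.2) @[z --> (t, p)] --> (- t, p).
    apply: (@cvg_pair _ _ _ (nbhs (t, p)) (nbhs (- t)) (nbhs p)); last exact: cvg_snd.
    by apply: cvgN; exact: cvg_fst.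
  have /(_ (- t, p)) hc := fc.
  exact: (cvg_comp _ _ h hc).
- by move=> p; rewrite oppr0.
- by move=> r t p; rewrite opprD.
Qed.

Lemma action_time_continuous phi t : flow_action phi -> continuous (phi t).
Proof.
move=> fp p; have h : (t, q) @[q --> p] --> (t, p).
  by apply: (@cvg_pair _ _ _ (nbhs p) (nbhs t) (nbhs p)); [exact: cvg_cst | exact: cvg_id].
have /(_ (t, p)) hc := action_continuous fp.
exact: (cvg_comp _ _ h hc).
Qed.

Lemma action_orbit_continuous phi p : flow_action phi -> continuous (phi^~ p).
Proof.
move=> fp t; have h : (u, p) @[u --> t] --> (t, p).
  by apply: (@cvg_pair _ _ _ (nbhs t) (nbhs t) (nbhs p)); [exact: cvg_id | exact: cvg_cst].
have /(_ (t, p)) hc := action_continuous fp.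
exact: (cvg_comp _ _ h hc).
Qed.

Lemma cvg_pinfty_near (f : R -> T) y U : f t @[t --> +oo] --> y -> nbhs y U ->
  exists2 t, 0 <= t & U (f t).
Proof.
move=> fy yU; have h : \forall t \near +oo, U (f t) := cvg_near fy yU.
near (pinfty_nbhs R) => t.
exists t; near: t; first exact: nbhs_pinfty_ge.
exact: h.
Unshelve. all: end_near. Qed.

Lemma basin_shift phi L s x t : flow_action phi -> L x ->
  phi u (phi t x) @[u --> +oo] --> s -> basin phi L s x.
Proof.
move=> fp Lx h; split => //.
have sh : (u - t) @[u --> +oo] --> +oo.
  move=> A /= [r [rr rA]]; exists (r + t); split; first exact: num_real.
  by move=> u ru; apply: rA; rewrite ltrBrDr.
have := cvg_comp _ _ sh h; apply: cvg_trans; apply: near_eq_cvg.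
by apply: nearW => u /=; rewrite -(actionD fp) subrK.
Qed.

Section Action.
Variables (phi : R -> T -> T) (L : set T).
Hypotheses (fp : flow_action phi) (invL : forall t x, L x -> L (phi t x)).

(** A convergent orbit enters the interior of the set where convergence is
    guaranteed after a finite time t, and phi t is continuous. *)
Lemma basin_open s x : attracts phi L s -> basin phi L s x ->
  \forall y \near x, L y -> basin phi L s y.
Proof.
move=> [_ As] [Lx xs].
have [t _ tV] := cvg_pinfty_near xs (nbhs_interior As).
have h : \forall y \near x, L (phi t y) -> phi u (phi t y) @[u --> +oo] --> s.
  have /(_ x) ct := @action_time_continuous _ t fp; exact: (cvg_near ct tV).
apply: filterS h => y hy Ly; apply: (basin_shift fp Ly (hy _)).
exact: invL.
Qed.

Lemma basin_invariant s x t : basin phi L s x -> basin phi L s (phi t x).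
Proof.
move=> [Lx xs]; apply: (basin_shift (t := - t)) => //; first exact: invL.
by have -> : phi (- t) (phi t x) = x by rewrite -(actionD fp) addNr (action0 fp).
Qed.

Lemma omega_cvg s x : phi t x @[t --> +oo] --> s -> omega_set phi x `<=` [set s].
Proof.
move=> xs y [t [tk ty]]; have := cvg_comp _ _ tk xs => h.
exact: (cvg_unique hT ty h).
Qed.

Lemma omega_in x : closed L -> L x -> omega_set phi x `<=` L.
Proof.
move=> cL Lx y [t [tk ty]].
apply: cL => B yB; near \oo => k.
exists (phi (t k) x); split; first exact: invL.
by near: k; exact: (cvg_near ty yB).
Unshelve. all: end_near.
Qed.

(** The orbit of x comes close to y, hence enters the open basin, hence
    converges to s, which is then its only limit point. *)
Lemma omega_attracting s x y : attracts phi L s -> L x -> omega_set phi x y ->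
  basin phi L s y -> y = s.
Proof.
move=> As Lx oy ys; have [t [tk ty]] := oy.
have h := cvg_near ty (basin_open As ys).
have [k /(_ (invL _ Lx)) [_ hk]] : exists k, L (phi (t k) x) -> basin phi L s (phi (t k) x).
  by near \oo => k; exists k; near: k.
have [_ xs] := basin_shift fp Lx hk.
exact: omega_cvg xs _ oy.
Unshelve. all: end_near. Qed.

(** Going back in time from the visits of the orbit of x near y, one reaches
    neighbourhoods of s; by stability of s for the reversed flow, going back
    further to time 0 stays there, so x lies in every neighbourhood of s. *)
Lemma omega_repelling s x y : attracts (backward phi) L s -> L x -> omega_set phi x y ->
  basin (backward phi) L s y -> x = s.
Proof.
move=> [As _] Lx [t [tk ty]] [Ly ys]; apply/esym/hausdorff_nbhs_eq => // U sU.
have [r r0 rV] := cvg_pinfty_near ys (nbhs_interior (As U sU)).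
have h : \forall z \near y, L (phi (- r) z) ->
    forall u, 0 <= u -> U (backward phi u (phi (- r) z)).
  have /(_ y) ct := @action_time_continuous _ (- r) fp; exact: (cvg_near ct rV).
have {}h := cvg_near ty h.
have h2 : \forall k \near \oo, r <= t k.
  have hr : \forall z \near +oo, r <= z by apply: nbhs_pinfty_ge; exact: num_real.
  exact: (cvg_near tk hr).
near \oo => k.
have tr : r <= t k by near: k.
have : L (phi (- r) (phi (t k) x)) ->
    forall u, 0 <= u -> U (backward phi u (phi (- r) (phi (t k) x))).
  by near: k.
move=> /(_ (invL _ (invL _ Lx)) (t k - r)); rewrite subr_ge0 tr => /(_ isT).
by rewrite /backward -!(actionD fp) [X in phi X x](_ : _ = 0) ?(action0 fp)//; ring.
Unshelve. all: end_near. Qed.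

End Action.

(** What remains of L outside the basins of the points of S. The conditions
    are symmetric in time, so that omega- and alpha-limit sets are treated by
    the same lemma. *)
Definition remainder phi L S : set T := [set x | L x /\ forall s, S s ->
  ~ (attracts phi L s /\ basin phi L s x) /\
  ~ (attracts (backward phi) L s /\ basin (backward phi) L s x)].

Lemma remainder_backward phi L S : remainder (backward phi) L S = remainder phi L S.
Proof.
by apply/seteqP; split => x [Lx h]; split => // s /h[h1 h2]; rewrite backwardK in h2 *; split.
Qed.

Section Remainder.
Variables (phi : R -> T -> T) (L S : set T).
Hypotheses (fp : flow_action phi) (invL : forall t x, L x -> L (phi t x)).
Hypotheses (cL : closed L) (SL : S `<=` L).
Hypothesis fixS : forall s t, S s -> phi t s = s.
Hypothesis AS : forall s, S s -> attracts phi L s \/ attracts (backward phi) L s.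

Let fpb := action_backward fp.
Let invLb t x : L x -> L (backward phi t x). Proof. exact: invL. Qed.

Lemma remainder_closed : closed (remainder phi L S).
Proof.
move=> x clx; have Lx : L x.
  by apply: cL => B /clx [y [[Ly _] By]]; exists y.
split => // s Ss; split.
- move=> [As Bs]; have [y [[Ly /(_ s Ss)[h _]] By]] := clx _ (basin_open fp invL As Bs).
  by apply: h; split => //; exact: By.
- move=> [As Bs]; have [y [[Ly /(_ s Ss)[_ h]] By]] := clx _ (basin_open fpb invLb As Bs).
  by apply: h; split => //; exact: By.
Qed.

Lemma remainder_invariant t x : remainder phi L S x -> remainder phi L S (phi t x).
Proof.
move=> [Lx h]; split; first exact: invL.
move=> s /h [h1 h2]; split.
- move=> [As Bs]; apply: h1; split => //.
  by have := basin_invariant fp invL (- t) Bs; rewrite -(actionD fp) addNr (action0 fp).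
- move=> [As Bs]; apply: h2; split => //.
  by have := basin_invariant fpb invLb t Bs; rewrite /backward -(actionD fp) addNr (action0 fp).
Qed.

Lemma remainder_disjoint : remainder phi L S `&` S = set0.
Proof.
rewrite -subset0 => s [[Ls h] Ss]; have [h1 h2] := h s Ss.
case: (AS Ss) => As; [apply: h1|apply: h2]; split => //; split => //.
- by under eq_fun do rewrite fixS//; exact: cvg_cst.
- by rewrite /backward; under eq_fun do rewrite fixS//; exact: cvg_cst.
Qed.

Lemma omega_remainder x : L x -> ~ S x -> omega_set phi x `<=` remainder phi L S `|` S.
Proof.
move=> Lx nSx y oy; have Ly := omega_in invL cL Lx oy.
have [Sy|nSy] := pselect (S y); [by right|left; split => // s Ss; split].
- by move=> [As Bs]; apply: nSy; rewrite (omega_attracting fp invL As Lx oy Bs).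
- by move=> [As Bs]; apply: nSx; rewrite (omega_repelling fp invL As Lx oy Bs).
Qed.

Lemma attracted_isolated s : S s -> exists2 U, nbhs s U & finite_set (S `&` U).
Proof.
move=> Ss.
suff [U sU h] : exists2 U, nbhs s U & forall x, U x -> S x -> x = s.
  by exists U => //; apply: sub_finite_set (finite_set1 s) => x [Sx Ux]; exact: h.
case: (AS Ss) => -[_ As]; eexists; [exact: As| |exact: As|] => x hx Sx.
- have := hx (SL Sx); under eq_fun do rewrite fixS//.
  by move=> h; apply: (cvg_unique hT (cvg_cst x) h).
- have := hx (SL Sx); rewrite /backward; under eq_fun do rewrite fixS//.
  by move=> h; apply: (cvg_unique hT (cvg_cst x) h).
Qed.

End Remainder.

End Basins.

(** * A contracting time map makes a fixed point attracting *)

Section ContractingTime.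
Context {R : realType} {n : nat} {T : topologicalType} (c : chart R n T) (s : T).
Hypothesis cs : dom c s.

Definition chart_disp (p : T) : 'rV[R]_n := fwd c p - fwd c s.

Definition chart_ball (r : R) : set T := [set p | dom c p /\ `|chart_disp p| < r].

Lemma chart_disp_cvg : chart_disp p @[p --> s] --> (0 : 'rV[R]_n).
Proof.
rewrite -(subrr (fwd c s)); apply: cvgB; last exact: cvg_cst.
exact: fwd_continuous.
Qed.

Lemma chart_ball_nbhs r : 0 < r -> nbhs s (chart_ball r).
Proof.
move=> r0; have h : \forall p \near s, dom c p.
  by apply: open_nbhs_nbhs; split => //; exact: dom_open.
have /cvgr0Pnorm_lt /(_ r r0) h2 := chart_disp_cvg.
by apply: filterS2 h h2 => p; split.
Qed.

Lemma chart_ball_sub U : nbhs s U -> exists2 r, 0 < r & chart_ball r `<=` U.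
Proof.
move=> sU; have bc : bwd c y @[y --> fwd c s] --> s.
  by rewrite -[X in _ --> X](fwdK cs); apply: bwd_continuous; exact: fwd_img.
have /nbhs_ballP [r r0 rU] := cvg_near bc sU.
exists r => // p [cp pr]; rewrite -(fwdK cp); apply: rU.
by rewrite -ball_normE /= distrC.
Qed.

(** Iterating the halving gives geometric convergence along multiples of t;
    the times in between are controlled by compactness of [0, t], as phi u
    fixes s. *)
Lemma contraction_attracts (phi : R -> T -> T) (L : set T) (t : R) :
  flow_action phi -> (forall t x, L x -> L (phi t x)) ->
  (forall t, phi t s = s) -> 0 < t ->
  (\forall p \near s, L p -> `|chart_disp (phi t p)| <= 2^-1 * `|chart_disp p|) ->
  attracts phi L s.
Proof.
move=> fp invL fixs t0 con.
have tube U : nbhs s U -> \forall p \near s, forall u, 0 <= u <= t -> U (phi u p).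
  move=> sU; have cI : compact `[0, t] by exact: segment_compact.
  have /compact_near_coveringP nc := cI.
  have : \forall p \near s, `[0, t] `<=` (fun u => U (phi u p)).
    apply: nc => u _.
    have h : phi z.1 z.2 @[z --> (u, s)] --> phi u s.
      by have /(_ (u, s)) := action_continuous fp.
    by rewrite fixs in h; exact: (cvg_near h sU).
  by apply: filterS => p h u hu; apply: h; rewrite /= in_itv.
(* The ball must be mapped into the chart domain: chart positions mean nothing
   elsewhere. *)
have near_con : \forall p \near s,
    dom c (phi t p) /\ (L p -> `|chart_disp (phi t p)| <= 2^-1 * `|chart_disp p|).
  have ts : phi t p @[p --> s] --> s.
    by rewrite -[X in _ --> X](fixs t); exact: action_time_continuous.
  have cn : nbhs s (dom c) by apply: open_nbhs_nbhs; split => //; exact: dom_open.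
  by apply: filterS2 (cvg_near ts cn) con.
have [r0 r00 r0W] := chart_ball_sub near_con.
have iter_con p k : L p -> chart_ball r0 p ->
    chart_ball r0 (phi (k%:R * t) p) /\
    `|chart_disp (phi (k%:R * t) p)| <= 2^-1 ^+ k * `|chart_disp p|.
  move=> Lp pr; elim: k => [|k [IH1 IH2]].
    by rewrite mul0r (action0 fp) expr0 mul1r.
  have [h1 /(_ (invL _ _ Lp)) h2] := r0W _ IH1.
  rewrite mulrSr mulrDl mul1r addrC (actionD fp).
  have := normr_ge0 (chart_disp (phi (k%:R * t) p)) => h0.
  split; first by split => //; have [_] := IH1; lra.
  by rewrite exprS -mulrA; apply: le_trans h2 _; rewrite ler_pM2l.
have stable U : nbhs s U -> exists2 r, 0 < r &
    forall p, L p -> chart_ball r p -> forall u, 0 <= u -> U (phi u p).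
  move=> sU; have [r1 r10 r1V] := chart_ball_sub (tube U sU).
  exists (Num.min r1 r0); first by rewrite lt_min r10.
  move=> p Lp [cp]; rewrite lt_min => /andP[p1 p2] u u0.
  pose k := Num.truncn (u / t).
  have ut0 : 0 <= u / t by rewrite divr_ge0// ltW.
  have /andP[k1 k2] := truncn_itv ut0.
  rewrite ler_pdivlMr// in k1; rewrite ltr_pdivrMr// in k2.
  have [[h1 h1'] h2] := iter_con p k Lp (conj cp p2).
  have -> : phi u p = phi (u - k%:R * t) (phi (k%:R * t) p).
    by rewrite -(actionD fp) subrK.
  apply: r1V; last first.
    rewrite subr_ge0 k1 /= lerBlDl; apply: ltW; apply: lt_le_trans k2 _.
    by rewrite mulrSr mulrDl mul1r.
  split => //; apply: le_lt_trans h2 _; apply: le_lt_trans p1.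
  by rewrite ler_piMl// exprn_ile1// invf_le1 ?ler1n.
split.
  move=> U sU; have [r r1 rU] := stable U sU.
  by apply: filterS (chart_ball_nbhs r1) => p pr Lp; exact: rU.
apply: filterS (chart_ball_nbhs r00) => p pr Lp U sU.
have [r r1 rU] := stable U sU.
have [_ pr0] := pr.
pose k := Num.bound (r0 / r).
have k2 : r0 / r < 2 ^+ k by exact: upper_nthrootP.
have [[h1 _] h2] := iter_con p k Lp pr.
have kr : chart_ball r (phi (k%:R * t) p).
  split => //; apply: le_lt_trans h2 _.
  rewrite exprVn mulrC ltr_pdivrMr ?exprn_gt0//.
  by rewrite ltr_pdivrMr// mulrC in k2; apply: lt_trans k2.
have : \forall u \near +oo, k%:R * t <= u by apply: nbhs_pinfty_ge; exact: num_real.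
apply: filterS => u hu /=.
have -> : phi u p = phi (u - k%:R * t) (phi (k%:R * t) p).
  by rewrite -(actionD fp) subrK.
by apply: rU => //; [exact: invL | rewrite subr_ge0].
Qed.

End ContractingTime.

(** * Row vectors, linear maps and exponential decay *)

Section Decay.
Context {R : realType}.

Lemma expR_decay_small (K lambda e : R) : 0 < lambda -> 0 < e ->
  exists2 t, 0 < t & K * expR (- (lambda * t)) < e.
Proof.
move=> l0 e0; pose t := (1 + `|K|) / (lambda * e).
have K0 : 0 < 1 + `|K| by rewrite ltr_pwDl.
have t0 : 0 < t by rewrite divr_gt0// mulr_gt0.
exists t => //; rewrite expRN ltr_pdivrMr ?expR_gt0//.
have h : 1 + lambda * t <= expR (lambda * t) := expR_ge1Dx _.
have lt : lambda * t * e = 1 + `|K| by rewrite /t; field; rewrite !gt_eqF.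
have := ler_norm K.
have : (1 + lambda * t) * e <= expR (lambda * t) * e by rewrite ler_pM2r.
rewrite mulrDl mul1r lt [e * _]mulrC; lra.
Qed.

Lemma expR_decay_le0 (a K lambda : R) : 0 < lambda ->
  (forall t, 0 <= t -> a <= K * expR (- (lambda * t))) -> a <= 0.
Proof.
move=> l0 h; rewrite leNgt; apply/negP => a0.
have [t t0] := expR_decay_small K l0 a0.
by rewrite ltNge h// ltW.
Qed.

Lemma ler_expRN_le1 (lambda t : R) : 0 < lambda -> 0 <= t ->
  expR (- (lambda * t)) <= 1.
Proof. by move=> l0 t0; rewrite -expR0 ler_expR oppr_le0 mulr_ge0// ltW. Qed.

(** The variant for eigenvectors of a single time map, for which only the
    multiples of one time are available. *)
Lemma expR_decay_nat_le0 (a K lambda tau : R) :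
  0 <= K -> 0 < lambda -> 0 < tau ->
  (forall k : nat, a <= K * expR (- (lambda * (k%:R * tau)))) -> a <= 0.
Proof.
move=> K0 l0 t0 h; rewrite leNgt; apply/negP => a0.
have [t tp] := expR_decay_small K l0 a0.
apply/negP; rewrite -leNgt; have := h (Num.bound (t / tau)).
move=> /le_trans; apply; rewrite ler_wpM2l// ler_expR lerN2 ler_pM2l//.
rewrite -ler_pdivrMr//; apply/ltW; apply: le_lt_trans (archi_boundP _) => //.
by rewrite divr_ge0// ltW.
Qed.

End Decay.

Lemma split_vec (K : fieldType) (vT : vectType K) (U V : {vspace vT}) (x : vT) :
  (U + V)%VS = fullv -> exists u v, [/\ u \in U, v \in V & x = u + v].
Proof.
move=> UV; have : x \in (U + V)%VS by rewrite UV memvf.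
by move=> /memv_addP[u uU [v vV ->]]; exists u, v.
Qed.

(** By equality of dimensions, an injective endomorphism that maps U into U
    maps it onto U. *)
Lemma injective_preimage_mem (K : fieldType) (vT : vectType K) (A : 'End(vT))
    (U : {vspace vT}) v : lker A = 0%VS -> (A @: U <= U)%VS -> A v \in U -> v \in U.
Proof.
move=> kA AU Av.
have AUE : (A @: U)%VS = U.
  by apply/eqP; rewrite eqEdim AU limg_dim_eq ?leqnn//; rewrite kA capv0.
rewrite -AUE in Av; have /memv_imgP [u uU /(congr1 (fun z => z - A u)) E] := Av.
rewrite subrr -linearB in E.
have : v - u \in lker A by rewrite memv_ker E.
by rewrite kA memv0 subr_eq0 => /eqP ->.
Qed.

Section RowVectors.
Context {R : realType}.

Lemma coord_norm_le m (v : 'rV[R]_m) j : `|v 0 j| <= `|v|.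
Proof.
by rewrite [leRHS]mx_normrE; apply: (le_trans _ (le_bigmax _ (fun ij => `|v ij.1 ij.2|) (0, j))).
Qed.

Lemma rV_norm_le m (v : 'rV[R]_m) a : 0 <= a -> (forall j, `|v 0 j| <= a) -> `|v| <= a.
Proof.
move=> a0 h; rewrite [leLHS]mx_normrE; apply: bigmax_le => // -[i j] _ /=.
by rewrite ord1.
Qed.

Lemma linear_rV_bound n (W : normedModType R)
    (f : {linear 'rV[R]_n -> W}) :
  exists2 k : R, 0 < k & forall v, `|f v| <= k * `|v|.
Proof.
exists (1 + \sum_(i < n) `|f (delta_mx 0 i)|).
  by rewrite ltr_pwDl// sumr_ge0.
move=> v; rewrite {1}(row_sum_delta v) linear_sum mulrDl.
apply: (@le_trans _ _ ((\sum_(i < n) `|f (delta_mx 0 i)|) * `|v|)); last first.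
  by rewrite lerDr mul1r.
rewrite mulr_suml; apply: le_trans (ler_norm_sum _ _ _) _.
apply: ler_sum => i _; rewrite linearZ normrZ mulrC ler_wpM2l//.
exact: coord_norm_le.
Qed.

Lemma linear_rV_continuous n (W : normedModType R)
    (f : {linear 'rV[R]_n -> W}) : continuous f.
Proof.
have [k k0 fk] := linear_rV_bound f.
apply: bounded_linear_continuous; apply/linear_boundedP.
near=> r => x; apply: le_trans (fk x) _; apply: ler_wpM2r => //; near: r.
Unshelve. all: by end_near. Qed.

Lemma linear_bound n (W : normedModType R) (f : 'rV[R]_n -> W) : linear f ->
  exists2 k : R, 0 < k & forall v, `|f v| <= k * `|v|.
Proof.
move=> lf; pose F : {linear 'rV[R]_n -> W} :=
  HB.pack f (GRing.isLinear.Build R 'rV[R]_n W *:%R f lf).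
exact: (linear_rV_bound F).
Qed.

Lemma row_mx_norm_le m1 m2 (a : 'rV[R]_m1) (b : 'rV[R]_m2) :
  `|row_mx a b| <= `|a| + `|b|.
Proof.
apply: rV_norm_le => [|j]; first by rewrite addr_ge0.
rewrite mxE; case: (fintype.split j) => k; apply: le_trans (coord_norm_le _ _) _.
  by rewrite lerDl.
by rewrite lerDr.
Qed.

(** A subspace presented by equations: membership up to a small error can then
    be measured by the norm of q v. *)
Lemma vspace_annihilator n (U : {vspace 'rV[R]_n}) :
  exists q : {linear 'rV[R]_n -> 'rV[R]_n}, forall v, q v = 0 <-> v \in U.
Proof.
pose f v : 'rV[R]_n := v - projv U v.
have lf : linear f.
  by move=> a u v; rewrite /f linearP scalerBr opprD !addrA; congr (_ + _); rewrite addrAC.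
pose q : {linear 'rV[R]_n -> 'rV[R]_n} :=
  HB.pack f (GRing.isLinear.Build R 'rV[R]_n 'rV[R]_n *:%R f lf).
exists q => v; change (f v = 0 <-> v \in U); rewrite /f; split => [/subr0_eq ->|vU].
  exact: memv_proj.
by rewrite projv_id ?subrr.
Qed.

(** An approximate solution of f v = 0 is close to an exact one, with a linear
    estimate; the exact one is obtained by subtracting a preimage of f v. *)
Lemma pseudo_inverse_bound n m (f : 'Hom('rV[R]_n, 'rV[R]_m)) :
  exists2 K, 0 < K & forall v, exists2 l, l \in lker f & `|v - l| <= K * `|f v|.
Proof.
have [K K0 h] := linear_bound (linearP (f^-1)%VF).
exists K => // v; exists (v - (f^-1)%VF (f v)).
  by rewrite memv_ker linearB /= limg_lfunVK ?subrr// memv_img ?memvf.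
rewrite subKr; exact: h.
Qed.

(** Quantitative closedness of a bundle: vectors spanned by a frame b close to
    a free family e almost satisfy the equations q = 0 of the span of e. The
    point is the uniformity in the coefficients a, which are bounded by the
    norm of the combination because e is free. *)
Lemma frame_annihilator (T : Type) (F : set_system T) (FF : Filter F) n m d
    (b : 'I_d -> T -> 'rV[R]_n) (e : d.-tuple 'rV[R]_n)
    (q : {linear 'rV[R]_n -> 'rV[R]_m}) : free e ->
  (forall i : 'I_d, q e`_i = 0) -> (forall i : 'I_d, b i p @[p --> F] --> e`_i) ->
  forall eps, 0 < eps -> \forall p \near F, forall a : 'I_d -> R,
   `|q (\sum_i a i *: b i p)| <= eps * `|\sum_i a i *: b i p|.
Proof.
move=> fe qe be eps eps0.
have [Kq Kq0 hq] := linear_rV_bound q.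
have [K K0 hK] : exists2 K, 0 < K & forall v, \sum_i `|coord e i v| <= K * `|v|.
  have /choice [k hk] : forall i, exists k : R, 0 < k /\ forall v, `|coord e i v| <= k * `|v|.
    move=> i; have [k k0 hk] := linear_bound (W := R^o) (linearP (coord e i)).
    by exists k.
  exists (1 + \sum_i k i).
    by rewrite ltr_pwDl// sumr_ge0// => i _; have [/ltW] := hk i.
  move=> v; rewrite mulrDl mul1r mulr_suml; apply: le_trans (ler_sum _ (fun i _ => (hk i).2 v)) _.
  by rewrite lerDr.
(* The first bound makes the sum of the coefficients at most 2 K times the
   norm of the combination, the second one absorbs this constant. *)
pose delta := Num.min (2 * K)^-1 (eps / (2 * K * Kq)).
have d0 : 0 < delta by rewrite lt_min invr_gt0 divr_gt0 ?mulr_gt0.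
have : \forall p \near F, forall i : 'I_d, `|e`_i - b i p| < delta.
  apply: filter_forall => i; have /cvgrPdist_lt /(_ _ d0) := be i; exact.
apply: filterS => p hp a; set w := \sum_i _; pose s := \sum_i `|a i|.
pose z := \sum_i a i *: (b i p - e`_i).
have wE : w = \sum_i a i *: e`_i + z.
  by rewrite /w /z -big_split; apply: eq_bigr => i _ /=; rewrite -scalerDr subrKC.
have zb : `|z| <= s * delta.
  apply: le_trans (ler_norm_sum _ _ _) _; rewrite /s mulr_suml; apply: ler_sum => i _.
  by rewrite normrZ ler_wpM2l// distrC ltW.
have sb : s <= K * `|w - z|.
  have -> : w - z = \sum_i a i *: e`_i by rewrite wE addrK.
  apply: le_trans (hK _); apply: ler_sum => i _.
  by rewrite coord_sum_free.
have qw : q w = q z.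
  rewrite wE linearD linear_sum big1 ?add0r// => i _.
  by rewrite linearZ /= qe scaler0.
have s0 : 0 <= s by rewrite sumr_ge0.
have wz : `|w - z| <= `|w| + `|z| := ler_normB _ _.
have dK : K * delta <= 2^-1.
  have : delta <= (2 * K)^-1 by rewrite ge_min lexx.
  rewrite -(@ler_pM2l _ K)// => /le_trans; apply.
  by rewrite invfM mulrCA divff ?mulr1// gt_eqF.
have s2 : s <= 2 * K * `|w|.
  have h1 : K * `|w - z| <= K * (`|w| + s * delta).
    by rewrite ler_wpM2l ?(ltW K0)//; apply: le_trans wz _; rewrite lerD2l.
  have h2 : s * (K * delta) <= s * 2^-1 by rewrite ler_wpM2l.
  move: (le_trans sb h1) h2; lra.
rewrite qw; apply: le_trans (hq z) _.
have dKq : Kq * delta * (2 * K) <= eps.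
  have : delta <= eps / (2 * K * Kq) by rewrite ge_min lexx orbT.
  rewrite ler_pdivlMr ?mulr_gt0// => /(le_trans _); apply.
  by rewrite le_eqVlt; apply/orP; left; apply/eqP; ring.
have h3 : Kq * `|z| <= Kq * (s * delta) by rewrite ler_wpM2l// ltW.
have h4 : s * (Kq * delta) <= 2 * K * `|w| * (Kq * delta).
  by rewrite ler_wpM2r// mulr_ge0// ltW.
have h5 : Kq * delta * (2 * K) * `|w| <= eps * `|w| by rewrite ler_wpM2r.
lra.
Qed.

End RowVectors.

(** * Differentials *)

Section Differentials.
Context {R : realType} {V W : normedModType R}.
Implicit Types (f g : V -> W) (x : V).

Lemma near_eq_is_diff f g x (df : V -> W) :
  (\near x, f x = g x) -> is_diff x f df -> is_diff x g df.
Proof.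
move=> fg [dfx dfE].
have fgx : f x = g x := nbhs_singleton fg.
have [cdf fE] := (diff_locallyP _ _).1 dfx.
have gE : g \o shift x = cst (g x) + 'd f x +o_ 0 id.
  apply/eqaddoP => e e0; move/eqaddoP: fE => /(_ e e0) fE.
  have fgs : \forall h \near (0 : V), f (h + x) = g (h + x).
    have : (h + x) @[h --> (0:V)] --> x.
      by rewrite -[X in _ --> X]add0r; apply: cvgD; [exact: cvg_id|exact: cvg_cst].
    by move=> /(_ _ fg).
  by apply: filterS2 fE fgs => h; rewrite !fctE /= => hf <-; rewrite -fgx.
have dgE : 'd g x = 'd f x :> (V -> W) := diff_unique cdf gE.
split; last by rewrite dgE.
by apply/diff_locallyP; rewrite dgE.
Qed.

Lemma is_diffE f x (df : V -> W) v : is_diff x f df -> 'd f x v = df v.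
Proof. by move=> [_ ->]. Qed.

Lemma differentiable_approx f x : differentiable f x -> forall e, 0 < e ->
  \forall y \near x, `|f y - f x - 'd f x (y - x)| <= e * `|y - x|.
Proof.
move=> dfx e e0; have [_ /eqaddoP /(_ e e0) fE] := (diff_locallyP _ _).1 dfx.
have : (y - x) @[y --> x] --> (0 : V).
  by rewrite -(subrr x); apply: cvgB; [exact: cvg_id|exact: cvg_cst].
move=> /(_ _ fE); rewrite /nbhs /=; apply: filterS => y /=.
by rewrite !fctE /= subrK opprD addrA.
Qed.

End Differentials.

Lemma is_derive_comp (R : realType) (V W : normedModType R) (f : R -> V)
    (h : V -> W) (s : R) (v : V) :
  is_derive s 1 f v -> differentiable h (f s) ->
  is_derive s 1 (h \o f) ('d h (f s) v).
Proof.
move=> [/derivable1_diffP df <-] dh.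
have dhf : differentiable (h \o f) s by exact: differentiable_comp.
split; first exact/derivable1_diffP.
by rewrite !deriveE// diff_comp.
Qed.

Section MeanValue.
Context {R : realType}.

(** The scalar mean value theorem for each coordinate of q o f; a supremum
    norm on coordinates costs no constant. *)
Lemma mean_value_rV n m (q : {linear 'rV[R]_n -> 'rV[R]_m})
    (f df : R -> 'rV[R]_n) (tau B : R) :
  0 <= tau -> (forall r, 0 <= r <= tau -> is_derive r 1 f (df r)) ->
  (forall r, 0 <= r <= tau -> `|q (df r)| <= B) ->
  `|q (f tau - f 0)| <= tau * B.
Proof.
move=> t0 fd qB.
have B0 : 0 <= B by apply: le_trans (qB 0 _) => //; rewrite lexx.
apply: rV_norm_le => [|j]; first by rewrite mulr_ge0.
pose k (v : 'rV[R]_n) : R := q v 0 j.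
have kl : linear k.
  by move=> a u v; rewrite /k linearP !mxE.
pose kL : {linear 'rV[R]_n -> R^o} :=
  HB.pack k (GRing.isLinear.Build R 'rV[R]_n R^o *:%R k kl).
have kc : continuous (kL : 'rV[R]_n -> R^o) by exact: linear_rV_continuous.
have kd r : 0 <= r <= tau -> is_derive r 1 (kL \o f) (kL (df r)).
  move=> hr; have := is_derive_comp (fd r hr) (linear_differentiable (f r) kc).
  by rewrite diff_lin.
have [r] : exists2 r, r \in `[0, tau] & (kL \o f) tau - (kL \o f) 0 = kL (df r) * (tau - 0).
  apply: (@MVT_segment R (kL \o f) (fun r => kL (df r))) => // [r|].
    by rewrite in_itv /= => /andP[h1 h2]; apply: kd; rewrite !ltW.
  apply: derivable_within_continuous => r; rewrite in_itv /= => hr.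
  by have [] := kd r hr.
rewrite in_itv /= subr0 => hr hE.
have -> : q (f tau - f 0) 0 j = kL (df r) * tau by rewrite -hE linearB !mxE.
rewrite normrM (ger0_norm t0) mulrC ler_wpM2l//.
exact: le_trans (coord_norm_le _ _) (qB _ hr).
Qed.

End MeanValue.

(** * Charts and tangent maps *)

Section TangentMaps.
Context {R : realType} {n : nat} (M : manifold R n).
Implicit Types (c : chart R n M) (p : M) (v : 'rV[R]_n).

HB.instance Definition _ c p := GRing.Linear.copy (tcoord c p)
  ('d (fwd c \o bwd (chart_at p)) (fwd (chart_at p) p)).
HB.instance Definition _ c p := GRing.Linear.copy (tvec c p)
  ('d (fwd (chart_at p) \o bwd c) (fwd c p)).
HB.instance Definition _ f p := GRing.Linear.copy (@tmap R n M f p)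
  ('d (fwd (chart_at (f p)) \o f \o bwd (chart_at p)) (fwd (chart_at p) p)).

Lemma dom_nbhs c p : dom c p -> nbhs p (dom c).
Proof. by move=> cp; apply: open_nbhs_nbhs; split => //; exact: dom_open. Qed.

Lemma img_nbhs c y : img c y -> nbhs y (img c).
Proof. by move=> cy; apply: open_nbhs_nbhs; split => //; exact: img_open. Qed.

Lemma bwd_cvg c p : dom c p -> bwd c y @[y --> fwd c p] --> p.
Proof.
move=> cp; rewrite -[X in _ --> X](fwdK cp).
by apply: bwd_continuous; exact: fwd_img.
Qed.

Lemma trans_differentiable c c' p : atlas c -> atlas c' -> dom c p -> dom c' p ->
  differentiable (fwd c' \o bwd c) (fwd c p).
Proof.
move=> ac ac' cp cp'; have [+ _] := atlas_smooth ac ac' 1.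
by apply; split; rewrite ?fwdK//; exact: fwd_img.
Qed.

Lemma trans_comp c1 c2 c3 p v : atlas c1 -> atlas c2 -> atlas c3 ->
  dom c1 p -> dom c2 p -> dom c3 p ->
  'd (fwd c3 \o bwd c2) (fwd c2 p) ('d (fwd c2 \o bwd c1) (fwd c1 p) v) =
  'd (fwd c3 \o bwd c1) (fwd c1 p) v.
Proof.
move=> a1 a2 a3 d1 d2 d3.
have h1 := trans_differentiable a1 a2 d1 d2.
have h2 : differentiable (fwd c3 \o bwd c2) ((fwd c2 \o bwd c1) (fwd c1 p)).
  by rewrite /= fwdK//; exact: trans_differentiable.
have h3 := is_diff_comp (differentiableP h1) (differentiableP h2).
have h : is_diff (fwd c1 p) (fwd c3 \o bwd c1)
   ('d (fwd c3 \o bwd c2) ((fwd c2 \o bwd c1) (fwd c1 p)) \o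
    'd (fwd c2 \o bwd c1) (fwd c1 p)).
  apply: near_eq_is_diff h3.
  by apply: filterS (cvg_near (bwd_cvg d1) (dom_nbhs d2)) => y /= y2; rewrite fwdK.
apply/esym/(etrans (is_diffE v h)).
by rewrite /= fwdK.
Qed.

Lemma trans_id c p v : atlas c -> dom c p ->
  'd (fwd c \o bwd c) (fwd c p) v = v.
Proof.
move=> ac cp.
apply: (is_diffE v).
have h : is_diff (fwd c p) id (@id 'rV[R]_n) by exact: is_diff_id.
apply: near_eq_is_diff h.
by apply: filterS (img_nbhs (fwd_img cp)) => y cy /=; rewrite bwdK.
Qed.

Lemma tcoordK c p : atlas c -> dom c p -> cancel (tcoord c p) (tvec c p).
Proof.
move=> ac cp v; rewrite /tvec /tcoord trans_comp ?trans_id//;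
  by [exact: chart_at_atlas | exact: chart_at_dom].
Qed.

Lemma tcoord_chart_at p v : tcoord (chart_at p) p v = v.
Proof. by apply: trans_id; [exact: chart_at_atlas | exact: chart_at_dom]. Qed.

Lemma tmap_id p v : tmap (fun x : M => x) p v = v.
Proof. by apply: trans_id; [exact: chart_at_atlas | exact: chart_at_dom]. Qed.

Lemma tmap_comp (f h : M -> M) p v : {for p, continuous f} ->
  differentiable (fwd (chart_at (f p)) \o f \o bwd (chart_at p)) (fwd (chart_at p) p) ->
  differentiable (fwd (chart_at (h (f p))) \o h \o bwd (chart_at (f p)))
    (fwd (chart_at (f p)) (f p)) ->
  tmap (h \o f) p v = tmap h (f p) (tmap f p v).
Proof.
move=> cf df dh; rewrite /tmap.
set c := chart_at p; set c1 := chart_at (f p); set c2 := chart_at (h (f p)).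
have cp : dom c p := chart_at_dom p.
have c1p : dom c1 (f p) := chart_at_dom (f p).
have dh' : differentiable (fwd c2 \o h \o bwd c1) ((fwd c1 \o f \o bwd c) (fwd c p)).
  by rewrite /= fwdK.
have h3 := is_diff_comp (differentiableP df) (differentiableP dh').
have h4 : is_diff (fwd c p) (fwd c2 \o (h \o f) \o bwd c)
   ('d (fwd c2 \o h \o bwd c1) ((fwd c1 \o f \o bwd c) (fwd c p)) \o
    'd (fwd c1 \o f \o bwd c) (fwd c p)).
  apply: near_eq_is_diff h3.
  have : (f \o bwd c) y @[y --> fwd c p] --> f p.
    exact: cvg_comp (bwd_cvg cp) cf.
  by move/cvg_near => /(_ _ (dom_nbhs c1p)); apply: filterS => y /= y2; rewrite fwdK.
apply: (etrans (is_diffE v h4)).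
by rewrite /= fwdK.
Qed.

End TangentMaps.

(** * The tangent flow *)

Lemma is_flow_action (R : realType) n (M : manifold R n) (X : M -> 'rV[R]_n)
  (phi : R -> M -> M) : is_flow X phi -> flow_action phi.
Proof.
by move=> pf; split; [exact: flow_continuous pf | exact: flow0 pf | exact: flowD pf].
Qed.

(** The algebraic facts on the derivative cocycle from which the pointwise
    properties of the splittings follow. Unlike [is_flow], they pass to the
    reversed flow at once, by substituting - t for t. *)
Record tangent_flow (R : realType) (n : nat) (M : manifold R n)
    (X : M -> 'rV[R]_n) (phi : R -> M -> M) : Prop := TangentFlow {
  tflow0 : forall p, phi 0 p = p;
  tflowD : forall s t p, phi (s + t) p = phi s (phi t p);
  tflow_tmap0 : forall p v, tmap (phi 0) p v = v;
  tflow_tmapD : forall s t p v,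
    tmap (phi (s + t)) p v = tmap (phi s) (phi t p) (tmap (phi t) p v);
  tflow_field : forall t p, tmap (phi t) p (X p) = X (phi t p) }.

Section Flows.
Context {R : realType} {n : nat} (M : manifold R n).
Variables (X : M -> 'rV[R]_n) (phi : R -> M -> M).
Hypothesis phi_flow : is_flow X phi.

Lemma flow_differentiable t p c c' : atlas c -> atlas c' ->
  dom c p -> dom c' (phi t p) ->
  differentiable (fwd c' \o phi t \o bwd c) (fwd c p).
Proof.
move=> ac ac' cp cp'; have [+ _] := flow_C1 phi_flow ac ac'.
move=> /(_ (t, fwd c p)) /= F; pose i (y : 'rV[R]_n) : R * 'rV[R]_n := (t, y).
have di : differentiable i (fwd c p).
  exact: differentiable_pair (differentiable_cst _ _) (ex_diff).
apply: (@differentiable_comp _ _ _ _ i (fun z => fwd c' (phi z.1 (bwd c z.2))) _ di).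
by apply: F; rewrite fwdK//; split => //; exact: fwd_img.
Qed.

(** The generator gives the derivative at time 0 in the preferred chart only;
    the group law carries it to every time and the chain rule to every chart. *)
Lemma flow_path_derive s p c : atlas c -> dom c (phi s p) ->
  is_derive s 1 (fun r => fwd c (phi r p))
    (tcoord c (phi s p) (X (phi s p))).
Proof.
move=> ac cp; set q := phi s p; set cq := chart_at q.
have cqq : dom cq q := chart_at_dom q.
have acq : atlas cq := chart_at_atlas q.
have hsh : is_derive s 1 (fun r : R => r - s) (1 : R).
  by rewrite -[X in is_derive _ _ _ X]subr0; apply: is_deriveB.
have hq : is_derive s 1 ((fun t => fwd cq (phi t q)) \o (fun r : R => r - s)) (X q).
  have [/derivable1_diffP dg gE] := flow_generator phi_flow q.
  have := @is_derive_comp _ _ _ _ (fun t => fwd cq (phi t q)) s 1 hsh.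
  by rewrite subrr -deriveE// gE; apply.
have := @is_derive_comp _ _ _ _ (fwd c \o bwd cq) s (X q) hq.
rewrite /= subrr (flow0 phi_flow); move/(_ (trans_differentiable acq ac cqq cp)).
apply: near_eq_is_derive.
have : (phi^~ p) r @[r --> s] --> q by exact: (@action_orbit_continuous _ _ phi p (is_flow_action phi_flow)).
move/cvg_near => /(_ _ (dom_nbhs cqq)).
by apply: filterS => r /= rq; rewrite /q -(flowD phi_flow) subrK fwdK.
Qed.

(** The equivariance of X comes from differentiating phi t (phi r p) = phi r
    (phi t p) in r at 0. *)
Lemma flow_tangent_flow : tangent_flow X phi.
Proof.
have dphi t p : differentiable (fwd (chart_at (phi t p)) \o phi t \o bwd (chart_at p))
    (fwd (chart_at p) p).
  apply: flow_differentiable;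
    [exact: chart_at_atlas|exact: chart_at_atlas
    |exact: chart_at_dom|exact: chart_at_dom].
have phiDE s t : phi (s + t) = phi s \o phi t.
  by apply/funext => p; exact: (flowD phi_flow).
split.
- exact: (flow0 phi_flow).
- exact: (flowD phi_flow).
- move=> p v; rewrite (_ : phi 0 = fun x => x) ?tmap_id//.
  by apply/funext => x; exact: (flow0 phi_flow).
- move=> s t p v; rewrite phiDE; apply: tmap_comp => //.
  exact: (@action_time_continuous _ _ phi t (is_flow_action phi_flow)).
move=> t p; set c := chart_at p; set c' := chart_at (phi t p).
have cp : dom c p := chart_at_dom p.
have cp' : dom c' (phi t p) := chart_at_dom _.
have h0 := flow_generator phi_flow p.
have := @is_derive_comp _ _ _ _ (fwd c' \o phi t \o bwd c) _ _ h0.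
rewrite (flow0 phi_flow) => /(_ (dphi t p)) h1.
have h2 : is_derive (0 : R) 1 (fun s => fwd c' (phi s (phi t p))) (tmap (phi t) p (X p)).
  apply: near_eq_is_derive h1.
  have : (phi^~ p) r @[r --> (0 : R)] --> p.
    by rewrite -[X in _ --> X](flow0 phi_flow p); exact: (@action_orbit_continuous _ _ phi p (is_flow_action phi_flow)).
  move/cvg_near => /(_ _ (dom_nbhs cp)).
  by apply: filterS => r /= rq; rewrite fwdK// -!(flowD phi_flow) addrC.
have h3 := flow_generator phi_flow (phi t p).
by rewrite -(@derive_val _ _ _ _ _ _ _ h2) -(@derive_val _ _ _ _ _ _ _ h3).
Qed.

Lemma field_cvg p c : C1_field X -> atlas c -> dom c p ->
  tcoord c q (X q) @[q --> p] --> tcoord c p (X p).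
Proof.
move=> X1 ac cp; have [+ _] := X1 c ac.
pose f y := tcoord c (bwd c y) (X (bwd c y)).
move=> /(_ _ (fwd_img cp)) /differentiable_continuous h.
have : (f \o fwd c) q @[q --> p] --> f (fwd c p) := cvg_comp _ _ (fwd_continuous cp) h.
rewrite [f (fwd c p)]/f fwdK//.
apply: cvg_trans; apply: near_eq_cvg.
by apply: filterS (dom_nbhs cp) => q cq /=; rewrite /f fwdK.
Qed.

End Flows.

Section Reverse.
Context {R : realType} {n : nat} (M : manifold R n).
Variables (X : M -> 'rV[R]_n) (phi : R -> M -> M).

Lemma rev_tangent_flow : tangent_flow X phi ->
  tangent_flow (rev_field X) (rev_flow phi).
Proof.
move=> [f0 fD t0 tD fX]; rewrite /rev_flow /rev_field; split => *; rewrite ?oppr0 ?opprD//.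
by rewrite linearN; congr (- _); exact: fX.
Qed.

End Reverse.

(** * The Riemannian metric *)

Section Metric.
Context {R : realType} {n : nat} (M : manifold R n) (g : riemannian M).
Implicit Types (p : M) (u v w : 'rV[R]_n) (a : R).

Lemma innerC p u v : inner g p u v = inner g p v u.
Proof.
rewrite /inner; set A := u *m _ *m _.
have -> : A 0 0 = A^T 0 0 by rewrite [RHS]mxE.
by rewrite /A !trmx_mul trmxK (Defs.metric_sym g) mulmxA.
Qed.

Lemma innerDl p u v w : inner g p (u + v) w = inner g p u w + inner g p v w.
Proof. by rewrite /inner !mulmxDl mxE. Qed.

Lemma innerZl p a u v : inner g p (a *: u) v = a * inner g p u v.
Proof. by rewrite /inner -!scalemxAl mxE. Qed.

Lemma innerDr p u v w : inner g p w (u + v) = inner g p w u + inner g p w v.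
Proof. by rewrite innerC innerDl !(innerC p w). Qed.

Lemma innerZr p a u v : inner g p v (a *: u) = a * inner g p v u.
Proof. by rewrite innerC innerZl innerC. Qed.

Lemma inner0l p v : inner g p 0 v = 0.
Proof. by rewrite -(scale0r 0) innerZl mul0r. Qed.

Lemma inner_suml p k (F : 'I_k -> 'rV[R]_n) v :
  inner g p (\sum_i F i) v = \sum_i inner g p (F i) v.
Proof. exact: (big_morph (fun u => inner g p u v) (fun u w => innerDl p u w v) (inner0l p v)). Qed.

Lemma inner_ge0 p v : 0 <= inner g p v v.
Proof.
have [->|v0] := eqVneq v 0; first by rewrite inner0l.
exact/ltW/metric_pos.
Qed.

(** The Gram determinant is <v, v> <w, w>, where w is the component of u
    orthogonal to v. *)
Lemma gram_gt0 p u v : v != 0 -> (forall a, u != a *: v) ->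
  0 < inner g p u u * inner g p v v - inner g p u v ^+ 2.
Proof.
move=> v0 uv; have vv := metric_pos g p v0.
pose a := inner g p u v / inner g p v v.
have := uv a; rewrite -subr_eq0 => /(metric_pos g p).
rewrite -scaleNr innerDl !innerDr !innerZl !innerZr (innerC p v u) => h.
have /(mulr_gt0 vv) {h} := h; congr (0 < _); rewrite /a; field.
by rewrite gt_eqF.
Qed.

Lemma gram_ge0 p u v : 0 <= inner g p u u * inner g p v v - inner g p u v ^+ 2.
Proof.
have [->|v0] := eqVneq v 0; first by rewrite innerC !inner0l expr0n mulr0 subr0.
have [[a ->]|] := pselect (exists a, u = a *: v).
  by rewrite !innerZl !innerZr le_eqVlt; apply/orP; left; apply/eqP; ring.
move=> /forallNP h; apply/ltW/gram_gt0 => // a; apply/eqP; exact: h.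
Qed.

Lemma tnorm_ge0 p v : 0 <= tnorm g p v.
Proof. exact: sqrtr_ge0. Qed.

Lemma tnorm_gt0 p v : v != 0 -> 0 < tnorm g p v.
Proof. by move=> v0; rewrite sqrtr_gt0 metric_pos. Qed.

Lemma tnorm_le0 p v : tnorm g p v <= 0 -> v = 0.
Proof. by move=> h; apply/eqP/negPn/negP => /(tnorm_gt0 p); rewrite ltNge h. Qed.

Lemma tnormZ p a v : tnorm g p (a *: v) = `|a| * tnorm g p v.
Proof.
by rewrite /tnorm innerZl innerZr mulrA -expr2 sqrtrM ?sqr_ge0// sqrtr_sqr.
Qed.

Lemma tnormN p v : tnorm g p (- v) = tnorm g p v.
Proof. by rewrite -scaleN1r tnormZ normrN1 mul1r. Qed.

Lemma tnorm_triangle p u v : tnorm g p (u + v) <= tnorm g p u + tnorm g p v.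
Proof.
rewrite -(@ler_pXn2r _ 2)// ?nnegrE ?addr_ge0 ?tnorm_ge0//.
rewrite sqrrD /tnorm !sqr_sqrtr ?inner_ge0// innerDl !innerDr (innerC p v u).
have : inner g p u v <= Num.sqrt (inner g p u u) * Num.sqrt (inner g p v v).
  rewrite -sqrtrM ?inner_ge0//; apply: le_trans (ler_norm _) _.
  by rewrite -sqrtr_sqr ler_wsqrtr// -subr_ge0 gram_ge0.
rewrite mulr2n; lra.
Qed.

Lemma tnorm_subr p u v : tnorm g p u - tnorm g p v <= tnorm g p (u + v).
Proof.
rewrite lerBlDr -{1}(addrK v u) -(tnormN p v); exact: tnorm_triangle.
Qed.

Lemma tarea_gt0 p u v : v != 0 -> (forall a, u != a *: v) -> 0 < tarea g p u v.
Proof. by move=> v0 uv; rewrite sqrtr_gt0 gram_gt0. Qed.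

(** The squared norm of X is continuous, because in a chart it is a polynomial
    in the coordinates of X and the coefficients of the metric. *)
Lemma speed_bounded (X : M -> 'rV[R]_n) : compact [set: M] -> C1_field X ->
  exists2 C, 0 <= C & forall p, tnorm g p (X p) <= C.
Proof.
move=> cM X1; pose f p : R := inner g p (X p) (X p).
have cf : continuous f.
  move=> p; set c := chart_at p.
  have ac : atlas c := chart_at_atlas p.
  have cp : dom c p := chart_at_dom p.
  pose G i j (y : 'rV[R]_n) : R :=
    inner g (bwd c y) (tvec c (bwd c y) (delta_mx 0 i))
                      (tvec c (bwd c y) (delta_mx 0 j)).
  pose a (q : M) := tcoord c q (X q).
  have ha : a q @[q --> p] --> a p by exact: field_cvg.
  have hai i : a q 0 i @[q --> p] --> a p 0 i.
    have := @coord_continuous R 1 n 0 i; move/(_ (a p)) => h.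
    exact: cvg_comp _ _ ha h.
  have hG i j : G i j (fwd c q) @[q --> p] --> G i j (fwd c p).
    have := metric_smooth g i j ac 0; move/(_ _ (fwd_img cp)) => h.
    exact: cvg_comp _ _ (fwd_continuous cp) h.
  pose S (q : M) : R := \sum_(i < n) \sum_(j < n) a q 0 i * (a q 0 j * G i j (fwd c q)).
  have fE q : dom c q -> f q = S q.
    move=> cq; rewrite /f /S /G fwdK//.
    have -> : X q = \sum_i a q 0 i *: tvec c q (delta_mx 0 i).
      rewrite -[LHS](tcoordK ac cq) -/(a q) {1}(row_sum_delta (a q)) linear_sum.
      by apply: eq_bigr => i _; rewrite linearZ.
    rewrite inner_suml; apply: eq_bigr => i _.
    rewrite innerC inner_suml; apply: eq_bigr => j _.
    by rewrite innerZl innerZr mulrCA innerC.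
  have hS : S q @[q --> p] --> S p.
    apply: cvg_big => [|i _]; first exact: add_continuous.
    apply: cvg_big => [|j _]; first exact: add_continuous.
    by apply: cvgM; [exact: hai | apply: cvgM; [exact: hai|exact: hG]].
  rewrite /continuous_at (fE p cp); apply: cvg_trans hS; apply: near_eq_cvg.
  by apply: filterS (dom_nbhs cp) => q /fE.
have [[x _]|M0] := pselect ([set: M] !=set0); last first.
  by exists 0 => // p; exfalso; apply: M0; exists p.
have [m _ fm] : exists2 m, m \in [set: M] & forall t, t \in [set: M] -> f t <= f m.
  apply: compact_EVT_max => //; first by exists x.
  exact: continuous_subspaceT.
exists (Num.sqrt (f m)); first exact: sqrtr_ge0.
by move=> p; apply: ler_wsqrtr; apply: fm; rewrite inE.
Qed.

End Metric.

(** * Splittings along the intersection *)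

Section FlowActions.
Context {R : realType} {n : nat} (M : manifold R n).
Variables (X : M -> 'rV[R]_n) (phi : R -> M -> M).
Hypothesis tf : tangent_flow X phi.
Implicit Types (x : M) (t : R) (L : set M) (E : M -> {vspace 'rV[R]_n}).

Lemma tflowNK t x : phi (- t) (phi t x) = x.
Proof. by rewrite -(tflowD tf) addNr (tflow0 tf). Qed.

Lemma tflowKN t x : phi t (phi (- t) x) = x.
Proof. by rewrite -(tflowD tf) subrr (tflow0 tf). Qed.

Lemma tflow_tmapNK t x v : tmap (phi (- t)) (phi t x) (tmap (phi t) x v) = v.
Proof. by rewrite -(tflow_tmapD tf) addNr (tflow_tmap0 tf). Qed.

Lemma tflow_tmapKN t x v : tmap (phi t) (phi (- t) x) (tmap (phi (- t)) x v) = v.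
Proof. by rewrite -(tflow_tmapD tf) subrr (tflow_tmap0 tf). Qed.

Lemma invariant_flow L t x : Defs.invariant phi L -> L x -> L (phi t x).
Proof. by move=> inv Lx; rewrite -(inv t); exists x. Qed.

Lemma flow_closed_invariant L : (forall t x, L x -> L (phi t x)) -> Defs.invariant phi L.
Proof.
move=> h t; apply/seteqP; split => [_ [x Lx <-]|x Lx]; first exact: h.
by exists (phi (- t) x); [exact: h | exact: tflowKN].
Qed.

Lemma flow_invariant_mem L E t x v : flow_invariant phi L E -> L x -> v \in E x ->
  tmap (phi t) x v \in E (phi t x).
Proof. by move=> inv Lx vE; rewrite -inv// -[tmap _ _ v]lfunE memv_img. Qed.

End FlowActions.

Section Splittings.
Context {R : realType} {n : nat} (M : manifold R n) (g : riemannian M).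
Variables (X : M -> 'rV[R]_n).
Implicit Types (phi : R -> M -> M) (L : set M) (E F : M -> {vspace 'rV[R]_n}).

(** If the E-component e of X x were nonzero, it would grow exponentially
    along the backward orbit, and by domination the F-component would become
    negligible against it; but X is bounded. *)
Lemma field_in_dominating phi C L E F x : tangent_flow X phi ->
  (forall p, tnorm g p (X p) <= C) -> Defs.invariant phi L ->
  partially_hyperbolic_splitting g phi L E F -> L x -> X x \in F x.
Proof.
move=> tf XC inv [[_ [invE invF] full [K' [l' [K'0 l'0 dom]]]] [K [l [K0 l0 con]]]] Lx.
have [e [f [eE fF XE]]] := split_vec (X x) (full x Lx).1.
suff -> : X x = f by [].
suff e0 : e = 0 by rewrite XE e0 add0r.
apply: (@tnorm_le0 _ _ _ g x).
have C0 : 0 <= C by apply: le_trans (XC x); exact: tnorm_ge0.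
apply: (@expR_decay_le0 _ _ (C * K + K' * tnorm g x f) (Num.min l l')).
  by rewrite lt_min l0.
move=> t t0; set y := phi (- t) x.
set e' := tmap (phi (- t)) x e; set f' := tmap (phi (- t)) x f.
have Ly : L y by exact: invariant_flow inv Lx.
have eE' : e' \in E y by exact: (flow_invariant_mem _ invE).
have fF' : f' \in F y by exact: (flow_invariant_mem _ invF).
have yx : phi t y = x := tflowKN tf t x.
have h1 := con y e' t Ly eE' t0.
have h2 := dom y t e' f' Ly t0 eE' fF'.
rewrite !(tflow_tmapKN tf) yx in h1 h2.
have h3 : tnorm g y e' - tnorm g y f' <= C.
  apply: le_trans (tnorm_subr _ _ _ _) (le_trans _ (XC y)).
  by rewrite -(tflow_field tf) XE linearD.
have := tnorm_ge0 g x e; have := tnorm_ge0 g x f.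
have := tnorm_ge0 g y e'; have := tnorm_ge0 g y f'.
move: (tnorm g x e) (tnorm g x f) (tnorm g y e') (tnorm g y f') h1 h2 h3.
move=> a b a' b' h1 h2 h3 b'0 a'0 b0 a0.
have e1 : expR (- (l * t)) <= expR (- (Num.min l l' * t)).
  by rewrite ler_expR lerN2 ler_wpM2r// ge_min lexx.
have e2 : expR (- (l' * t)) <= expR (- (Num.min l l' * t)).
  by rewrite ler_expR lerN2 ler_wpM2r// ge_min lexx orbT.
have p1 := expR_gt0 (- (l * t)); have p2 := expR_gt0 (- (l' * t)).
move: (expR _) (expR (- (l' * t))) (expR (- (l * t))) e1 e2 p1 p2 h1 h2.
move=> m m' m1 e2 e1 p1 p2 h1 h2.
have CK0 : 0 <= C * K by rewrite mulr_ge0// ltW.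
have K'b0 : 0 <= K' * b by rewrite mulr_ge0// ltW.
have m0 : 0 <= m by apply: le_trans e1; exact: ltW.
have rhs0 : 0 <= (C * K + K' * b) * m by rewrite mulr_ge0// addr_ge0.
have [a'E|a'p] := leP a' 0.
  have a'E0 : a' = 0 by apply/eqP; rewrite eq_le a'E.
  by apply: le_trans h1 _; rewrite a'E0 mulr0.
have h4 : a * a' <= (C * K * m1 + K' * b * m') * a'.
  have : a * (a' - b') <= a * C by rewrite ler_wpM2l.
  have : C * a <= C * (K * m1 * a') by rewrite ler_wpM2l.
  nra.
rewrite ler_pM2r// in h4; apply: le_trans h4 _.
by rewrite mulrDl lerD// ler_wpM2l.
Qed.

End Splittings.

Section TwoSplittings.
Context {R : realType} {n : nat} (M : manifold R n) (g : riemannian M).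
Variables (X : M -> 'rV[R]_n).
Variables (phi : R -> M -> M) (Lp Lm : set M).
Variables (E1 F1 E2 F2 : M -> {vspace 'rV[R]_n}) (C : R).
Hypotheses (tf : tangent_flow X phi) (XC : forall p, tnorm g p (X p) <= C).
Hypotheses (invp : Defs.invariant phi Lp) (invm : Defs.invariant (rev_flow phi) Lm).
Hypothesis s1 : sectional_hyperbolic_splitting g phi Lp E1 F1.
Hypothesis s2 : sectional_hyperbolic_splitting g (rev_flow phi) Lm E2 F2.

Let tfr : tangent_flow (rev_field X) (rev_flow phi) := rev_tangent_flow tf.

Lemma rev_invariant_forward t x : Lm x -> Lm (phi t x).
Proof. by move=> Lx; rewrite -[t]opprK; exact: (invariant_flow (- t) invm Lx). Qed.

Lemma rev_bundle_forward t x v E : flow_invariant (rev_flow phi) Lm E -> Lm x ->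
  v \in (E x : {vspace 'rV[R]_n}) -> tmap (phi t) x v \in E (phi t x).
Proof.
by move=> inv Lx vE; have := flow_invariant_mem (- t) inv Lx vE; rewrite /rev_flow opprK.
Qed.

Lemma field_in_sectional_forward x : Lp x -> X x \in F1 x.
Proof. exact: (field_in_dominating tf XC invp s1.1). Qed.

Lemma field_in_sectional_backward x : Lm x -> X x \in F2 x.
Proof.
move=> Lx; rewrite -[X x]opprK memvN.
apply: (field_in_dominating (C := C) tfr _ invm s2.1 Lx) => p.
by rewrite /rev_field tnormN.
Qed.

(** Contraction for the reversed flow, read from the end point of the orbit
    segment. *)
Lemma rev_contracting_expanding : exists K l, [/\ 0 < K, 0 < l &
  expanding_with g phi Lm E2 K l].
Proof.
have [[[_ [invE _] _ _] [K [l [K0 l0 con]]]] _] := s2.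
exists K, l; split => // x v t Lx vE t0.
have := con _ _ t (rev_invariant_forward t Lx) (rev_bundle_forward t invE Lx vE) t0.
rewrite /rev_flow (tflowNK tf) (tflow_tmapNK tf) => h.
rewrite -mulrA ler_pdivrMl// -(@ler_pM2r _ (expR (- (l * t)))) ?expR_gt0//.
rewrite mulrAC -expRD subrr expR0 mul1r; apply: le_trans h _.
by rewrite mulrAC.
Qed.

(** Forwards v contracts and the field stays bounded, so e stays bounded; but
    vectors of E2 expand. *)
Lemma contracting_cap_expanding_plus_field x v e a :
  Lp x -> Lm x -> v \in E1 x -> e \in E2 x ->
  v = e + a *: X x -> e = 0.
Proof.
move=> Lpx Lmx vE1 eE2 vE.
have [[_ [K [l [K0 l0 con]]]] _] := s1.
have [K' [l' [K'0 l'0 ex]]] := rev_contracting_expanding.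
apply: (@tnorm_le0 _ _ _ g x).
have C0 : 0 <= C by apply: le_trans (XC x); exact: tnorm_ge0.
apply: (@expR_decay_le0 _ _ (K' * (K * tnorm g x v + `|a| * C)) l') => // t t0.
have h1 := con x v t Lpx vE1 t0.
have h2 := ex x e t Lmx eE2 t0.
have h3 : tnorm g (phi t x) (tmap (phi t) x e) <= K * tnorm g x v + `|a| * C.
  have -> : e = v + (- a) *: X x by rewrite vE scaleNr addrK.
  rewrite linearD linearZ /= (tflow_field tf).
  apply: le_trans (tnorm_triangle _ _ _ _) _; apply: lerD.
    apply: le_trans h1 _; rewrite ler_wpM2r ?tnorm_ge0//.
    by rewrite ler_piMr ?ler_expRN_le1// ltW.
  by rewrite tnormZ normrN ler_wpM2l.
have := le_trans h2 h3.
rewrite -mulrA ler_pdivrMl// -(@ler_pM2r _ (expR (- (l' * t)))) ?expR_gt0//.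
by rewrite mulrAC -expRD subrr expR0 mul1r.
Qed.

(** Independent u and v would span a parallelogram whose area grows
    exponentially in F1, while backwards from its image the area grows in F2. *)
Lemma sectional_line x u v : Lp x -> Lm x -> u \in F1 x -> u \in F2 x ->
  v \in F1 x -> v \in F2 x -> v != 0 -> exists a, u = a *: v.
Proof.
move=> Lpx Lmx u1 u2 v1 v2 v0; apply: contrapT => /forallNP uv.
have uv' a : u != a *: v by apply/eqP; exact: uv.
have := tarea_gt0 g x v0 uv'; rewrite ltNge => /negP; apply.
have [_ [K [l [K0 l0 ex]]]] := s1.
have [[[_ [_ invF] _ _] _] [K' [l' [K'0 l'0 ex']]]] := s2.
apply: (@expR_decay_le0 _ _ (K * K' * tarea g x u v) l) => // t t0.
have h1 := ex x u v t Lpx u1 v1 t0.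
have := ex' _ _ _ t (rev_invariant_forward t Lmx) (rev_bundle_forward t invF Lmx u2)
   (rev_bundle_forward t invF Lmx v2) t0.
rewrite /rev_flow (tflowNK tf) !(tflow_tmapNK tf) => h2.
have A0 : 0 <= tarea g (phi t x) (tmap (phi t) x u) (tmap (phi t) x v) by exact: sqrtr_ge0.
have h3 : 1 <= expR (l' * t) by rewrite -expR0 ler_expR mulr_ge0// ltW.
have : tarea g (phi t x) (tmap (phi t) x u) (tmap (phi t) x v) <= K' * tarea g x u v.
  by move: h2; rewrite -mulrA ler_pdivrMl//; apply: le_trans; rewrite ler_peMl.
move/(le_trans h1); rewrite -mulrA ler_pdivrMl// -(@ler_pM2r _ (expR (- (l * t)))) ?expR_gt0//.
by rewrite mulrAC -expRD subrr expR0 mul1r mulrA.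
Qed.

(** The sum is direct by the previous lemmas. Its dimension is dim E1 + 1 +
    dim E2 = 2n + 1 - dim F1 - dim F2, and dim F1 + dim F2 <= n + 1 as F1 and
    F2 meet in at most a line. *)
Lemma regular_splitting x : Lp x -> Lm x -> X x != 0 ->
  (E1 x + <[X x]> + E2 x)%VS = fullv /\ directv (E1 x + <[X x]> + E2 x).
Proof.
move=> Lpx Lmx Xx.
have [[[_ _ full1 _] _] _] := s1; have [[[_ _ full2 _] _] _] := s2.
have [f1 d1] := full1 x Lpx; have [f2 d2] := full2 x Lmx.
have XF1 := field_in_sectional_forward Lpx; have XF2 := field_in_sectional_backward Lmx.
have d1' : (\dim (E1 x) + \dim (F1 x) = \dim {:'rV[R]_n})%N.
  by rewrite -f1; apply/esym/eqP; move: d1; rewrite directvE.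
have d2' : (\dim (E2 x) + \dim (F2 x) = \dim {:'rV[R]_n})%N.
  by rewrite -f2; apply/esym/eqP; move: d2; rewrite directvE.
have dF : (\dim (F1 x :&: F2 x) <= 1)%N.
  apply: leq_trans (_ : (\dim <[X x]> <= 1)%N); last by rewrite dim_vline; case: eqP.
  apply/dimvS/subvP => u /[!memv_cap] /andP[u1 u2].
  have [a ->] := sectional_line Lpx Lmx u1 u2 XF1 XF2 Xx.
  by rewrite memvZ// memv_line.
have dsum := dimv_sum_cap (F1 x) (F2 x).
have dle : (\dim (F1 x + F2 x) <= \dim {:'rV[R]_n})%N by apply/dimvS/subvf.
have EX : (E1 x :&: <[X x]> = 0)%VS.
  apply/eqP; rewrite -subv0; apply/subvP => v /[!memv_cap] /andP[vE /vlineP[a va]].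
  rewrite memv0; apply/eqP.
  have vF : v \in F1 x by rewrite va memvZ.
  have : v \in (E1 x :&: F1 x)%VS by rewrite memv_cap vE.
  by move: d1; rewrite directv_addE /= => /and3P[_ _ /eqP->]; rewrite memv0 => /eqP.
have EXE : ((E1 x + <[X x]>) :&: E2 x = 0)%VS.
  apply/eqP; rewrite -subv0; apply/subvP => v /[!memv_cap] /andP[].
  move=> /memv_addP[e eE [w /vlineP[a ->] vE]] vE2; rewrite memv0; apply/eqP.
  apply: (@contracting_cap_expanding_plus_field x e v (- a)) => //.
  by rewrite vE scaleNr addrK.
have dX : \dim <[X x]> = 1%N by rewrite dim_vline Xx.
have dEX := dimv_sum_cap (E1 x) <[X x]>.
have dEXE := dimv_sum_cap (E1 x + <[X x]>) (E2 x).
rewrite EX EXE dimv0 dX in dEX dEXE.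
have dle' : (\dim (E1 x + <[X x]> + E2 x) <= \dim {:'rV[R]_n})%N by apply/dimvS/subvf.
split.
  apply/eqP; rewrite eqEdim subvf /=.
  lia.
rewrite directvE /=; apply/eqP; rewrite dim_vline Xx; lia.
Qed.

End TwoSplittings.

(** * Subbundles and displacements near a singularity *)

Section SubbundleNear.
Context {R : realType} {n : nat} (M : manifold R n).

(** A continuous frame of F in the chart at s puts [frame_annihilator] to
    work. *)
Lemma subbundle_near (L : set M) (F : M -> {vspace 'rV[R]_n}) (s : M) m
    (q : {linear 'rV[R]_n -> 'rV[R]_m}) :
  subbundle L F -> L s -> (forall v, v \in F s -> q v = 0) ->
  forall eps, 0 < eps -> \forall p \near s, L p -> forall v, v \in F p ->
    `|q (tcoord (chart_at s) p v)| <= eps * `|tcoord (chart_at s) p v|.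
Proof.
move=> sF Ls qF eps eps0; have [U [d [e [sU ec eb]]]] := sF s Ls.
set c := chart_at s; have cs : dom c s := chart_at_dom s.
have ac : atlas c := chart_at_atlas s.
pose A := (L `&` U) `&` dom c.
have As : A s by split => //; split => //; exact: nbhs_singleton.
pose b i p := tcoord c p (e i p).
have bs i : b i p @[p --> within A (nbhs s)] --> e i s.
  have /subspace_continuousP /(_ s As) := ec i c ac.
  have <- : tcoord c s (e i s) = e i s by exact: tcoord_chart_at. exact.
have es := eb s Ls (nbhs_singleton sU).
have efree : free [tuple e i s | i < d] by move/basis_free: es.
have eE p (i : 'I_d) : [tuple e i p | i < d]`_i = e i p by rewrite -tnth_nth tnth_mktuple.
have fa := @frame_annihilator R M (within A (nbhs s)) _ n m d b [tuple e i s | i < d] q efree.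
have /fa{}fa : forall i : 'I_d, q [tuple e i s | i < d]`_i = 0.
  by move=> i; rewrite eE qF// -[e i s]eE; apply: (basis_mem es); rewrite mem_nth// size_tuple.
have /fa /(_ eps eps0){}fa : forall i : 'I_d, b i p @[p --> within A (nbhs s)] --> [tuple e i s | i < d]`_i.
  by move=> i; rewrite eE; exact: bs.
have {}fa : \forall p \near s, A p -> forall a : 'I_d -> R,
   `|q (\sum_i a i *: b i p)| <= eps * `|\sum_i a i *: b i p| by [].
have h3 : \forall p \near s, U p /\ dom c p.
  by apply: filterI => //; exact: dom_nbhs.
apply: filterS2 fa h3 => p h [Up cp] Lp v vF.
have Ap : A p by split.
have vE := coord_basis (eb p Lp Up) vF.
have -> : tcoord c p v = \sum_i coord [tuple e i p | i < d] i v *: b i p.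
  rewrite {1}vE linear_sum; apply: eq_bigr => i _.
  by rewrite linearZ eE.
exact: h.
Qed.

End SubbundleNear.

Section NearSingularity.
Context {R : realType} {n : nat} (M : manifold R n).
Variables (X : M -> 'rV[R]_n) (phi : R -> M -> M) (s : M).
Hypothesis phi_flow : is_flow X phi.
Hypothesis X1 : C1_field X.
Hypotheses (Xs : X s = 0) (fixs : forall t, phi t s = s).

Let c := chart_at s.
Let cs : dom c s. Proof. exact: chart_at_dom. Qed.
Let ac : atlas c. Proof. exact: chart_at_atlas. Qed.
Let h := chart_disp c s.
Let G p := tcoord c p (X p).

Lemma disp_linear t eps : 0 < eps ->
  \forall p \near s, `|h (phi t p) - tmap (phi t) s (h p)| <= eps * `|h p|.
Proof.
move=> eps0; have cts : dom c (phi t s) by rewrite fixs.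
have dt := flow_differentiable phi_flow ac ac cs cts.
have E : tmap (phi t) s = 'd (fwd c \o phi t \o bwd c) (fwd c s).
  by rewrite /tmap fixs.
have := cvg_near (fwd_continuous cs) (differentiable_approx dt eps0).
rewrite -E; move: (tmap (phi t) s) => D.
apply: filterS2 (dom_nbhs cs) => p cp /=.
by rewrite (fwdK cp) (fwdK cs) fixs; exact: id.
Qed.

(** X vanishes at s and is differentiable in the chart. *)
Lemma field_lipschitz : exists2 K, 0 < K & \forall p \near s, `|G p| <= K * `|h p|.
Proof.
have [dY _] := X1 ac.
have {}dY := dY _ (fwd_img cs).
pose Y (y : 'rV[R]_n) := tcoord c (bwd c y) (X (bwd c y)).
have [k k0 hk] := linear_rV_bound ('d Y (fwd c s)).
exists (1 + k); first by rewrite addr_gt0.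
have := cvg_near (fwd_continuous cs) (differentiable_approx dY ltr01).
have Gs : G s = 0 by rewrite /G Xs linear0.
move: (('d Y (fwd c s) : _ -> _)) hk => D hk.
apply: filterS2 (dom_nbhs cs) => p cp /=.
rewrite (fwdK cp) (fwdK cs) [tcoord c s (X s)]Gs subr0 mul1r => hp.
have -> : G p = (G p - D (h p)) + D (h p) by rewrite subrK.
apply: le_trans (ler_normD _ _) _; rewrite mulrDl mul1r; apply: lerD; last exact: hk.
exact: hp.
Qed.

Lemma disp_path_derive p r : dom c (phi r p) ->
  is_derive r 1 (fun u => h (phi u p)) (G (phi r p)).
Proof.
move=> crp; have := flow_path_derive phi_flow ac crp => H.
by rewrite -[X in is_derive _ _ _ X]subr0; apply: is_deriveB.
Qed.

(** A Gronwall estimate in disguise: if m is the time at which the orbit is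
    farthest from s, the speed up to m is at most K times that distance, so
    the orbit moves by at most half of it when tau K <= 1/2. *)
Lemma small_time : exists2 tau, 0 < tau &
  \forall p \near s, forall r, 0 <= r <= tau ->
    dom c (phi r p) /\ `|h (phi r p)| <= 2 * `|h p|.
Proof.
have [K K0 GK] := field_lipschitz.
have good : \forall p \near s, dom c p /\ `|G p| <= K * `|h p|.
  by apply: filterI GK; exact: dom_nbhs.
have cv : phi z.1 z.2 @[z --> ((0 : R), s)] --> s.
  by rewrite -[X in _ --> X](fixs 0); by have /(_ (0, s)) := action_continuous (is_flow_action phi_flow).
have [[A B] /= [/nbhs_ballP [d d0 dA] Bs] AB] := cvg_near cv good.
pose tau := Num.min (d / 2) (2 * K)^-1.
have t0 : 0 < tau by rewrite lt_min divr_gt0//= invr_gt0 mulr_gt0.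
have tK : tau * K <= 2^-1.
  have : tau <= (2 * K)^-1 by rewrite ge_min lexx orbT.
  rewrite -(ler_pM2r K0) => /le_trans; apply.
  by rewrite invfM -mulrA mulVf ?mulr1// gt_eqF.
exists tau => //; apply: filterS Bs => p Bp.
have gp r : 0 <= r <= tau -> dom c (phi r p) /\ `|G (phi r p)| <= K * `|h (phi r p)|.
  move=> /andP[r0 rt]; apply: (AB (r, p)); split => //=; apply: dA.
  rewrite -ball_normE /= sub0r normrN ger0_norm//; apply: le_lt_trans rt _.
  by rewrite gt_min ltr_pdivrMr// ltr_pMr// ltr1n.
pose f r := h (phi r p).
have fd r : 0 <= r <= tau -> is_derive r 1 f (G (phi r p)).
  by move=> /gp [? _]; exact: disp_path_derive.
have fc : {within `[0, tau], continuous f}.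
  apply: derivable_within_continuous => r; rewrite in_itv /= => hr.
  by have [] := fd r hr.
have [m mI fm] : exists2 m, m \in `[0, tau] & forall r, r \in `[0, tau] -> `|f r| <= `|f m|.
  apply: (@EVT_max R (fun r => `|f r|)); first exact: ltW.
  by move=> x; exact: continuous_comp (fc x) (@norm_continuous _ _ _).
move: mI; rewrite in_itv /= => /andP[m0 mt].
have := @mean_value_rV R n n idfun f (fun r => G (phi r p)) m (K * `|f m|) m0.
have rI r : 0 <= r <= m -> 0 <= r <= tau.
  by move=> /andP[-> /= /le_trans]; apply.
move=> /(_ (fun r hr => fd r (rI r hr))) mv.
have {}mv : `|f m - f 0| <= m * (K * `|f m|).
  apply: mv => r /rI hr; apply: le_trans (gp r hr).2 _.
  by rewrite ler_pM2l// fm// in_itv.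
have f0 : f 0 = h p by rewrite /f (flow0 phi_flow).
have fm2 : `|f m| <= 2 * `|h p|.
  have : `|f m| <= `|f m - f 0| + `|f 0| by rewrite -{1}(subrK (f 0) (f m)) ler_normD.
  have : m * (K * `|f m|) <= tau * K * `|f m|.
    by rewrite -mulrA ler_wpM2r// mulr_ge0// ltW.
  have : tau * K * `|f m| <= 2^-1 * `|f m| by rewrite ler_wpM2r.
  rewrite f0; move: mv; rewrite f0; lra.
move=> r hr; split; first exact: (gp r hr).1.
by apply: le_trans fm2; apply: fm; rewrite in_itv.
Qed.

(** If X almost satisfies the equations q = 0 along L, then so do the
    displacements over time tau, by the mean value theorem; to first order at
    s these are (D - 1) h with D the derivative of phi tau at s. *)
Lemma disp_annihilator (L : set M) m (q : {linear 'rV[R]_n -> 'rV[R]_m}) tau :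
  (forall t x, L x -> L (phi t x)) -> 0 < tau ->
  (\forall p \near s, forall r, 0 <= r <= tau ->
    dom c (phi r p) /\ `|h (phi r p)| <= 2 * `|h p|) ->
  (forall eps, 0 < eps -> \forall p \near s, L p -> `|q (G p)| <= eps * `|G p|) ->
  forall eps, 0 < eps -> \forall p \near s, L p ->
    `|q (tmap (phi tau) s (h p) - h p)| <= eps * `|h p|.
Proof.
move=> invL t0 st qG eps eps0.
have [K K0 GK] := field_lipschitz.
have [k k0 hk] := linear_rV_bound q.
(* Two errors, each at most half of eps: the one of the mean value estimate,
   where the distance to s may have doubled along the orbit, and the one of
   the linearization. *)
pose e1 := eps / (4 * K * tau).
have e10 : 0 < e1 by rewrite divr_gt0// !mulr_gt0.
pose e2 := eps / (2 * k).
have e20 : 0 < e2 by rewrite divr_gt0// !mulr_gt0.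
have good : \forall p \near s, (L p -> `|q (G p)| <= e1 * `|G p|) /\ `|G p| <= K * `|h p|.
  by apply: filterI GK; exact: qG.
have [r0 r00 r0G] := chart_ball_sub cs good.
have r02 : 0 < r0 / 2 by rewrite divr_gt0.
have near_ball := chart_ball_nbhs cs r02.
apply: filterS3 st (disp_linear tau e20) near_ball => p stp dl [cp pr] Lp.
have gp r : 0 <= r <= tau -> `|q (G (phi r p))| <= 2 * e1 * K * `|h p|.
  move=> hr; have [cr hr2] := stp r hr.
  have [] : (L (phi r p) -> `|q (G (phi r p))| <= e1 * `|G (phi r p)|) /\
      `|G (phi r p)| <= K * `|h (phi r p)|.
    apply: r0G; split => //; apply: le_lt_trans hr2 _.
    by rewrite mulrC -ltr_pdivlMr.
  move=> /(_ (invL _ _ Lp)) h1 h2; apply: le_trans h1 _.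
  have -> : 2 * e1 * K * `|h p| = e1 * (K * (2 * `|h p|)) by ring.
  apply: ler_wpM2l; first exact: ltW.
  by apply: le_trans h2 _; apply: ler_wpM2l => //; exact: ltW.
have := @mean_value_rV R n m q (fun r => h (phi r p)) (fun r => G (phi r p)) tau _ (ltW t0)
  (fun r hr => disp_path_derive (stp r hr).1) gp.
rewrite (flow0 phi_flow) => mv.
have {dl} := dl; move: (tmap (phi tau) s (h p)) => D dl.
have -> : q (D - h p) = q (h (phi tau p) - h p) - q (h (phi tau p) - D).
  move: (h (phi tau p)) (h p) => u w.
  by rewrite -linearB; congr (q _); rewrite [RHS]addrC opprB subrKA.
apply: le_trans (ler_normB _ _) _.
have b1 : tau * (2 * e1 * K * `|h p|) = eps / 2 * `|h p|.
  by rewrite /e1; field; rewrite !gt_eqF.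
have b2 : k * (e2 * `|h p|) = eps / 2 * `|h p|.
  by rewrite /e2; field; rewrite gt_eqF.
have b3 : `|q (h (phi tau p) - D)| <= eps / 2 * `|h p|.
  by apply: le_trans (hk _) _; rewrite -b2 ler_pM2l.
move: mv; rewrite b1; lra.
Qed.

End NearSingularity.

(** * Hyperbolic singularities *)

Section HyperbolicSingularity.
Context {R : realType} {n : nat} (M : manifold R n) (g : riemannian M).
Variables (X : M -> 'rV[R]_n) (phi : R -> M -> M) (s : M).
Hypothesis tf : tangent_flow X phi.
Hypotheses (Xs : X s = 0) (fixs : forall t, phi t s = s).
Hypothesis hyp : hyperbolic g X phi [set s].

Let D t v := tmap (phi t) s v.
Let N v := tnorm g s v.

Lemma singular_tmapD a b v : D (a + b) v = D a (D b v).
Proof. by rewrite /D (tflow_tmapD tf) fixs. Qed.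

(** At a singularity the flow direction is zero, and expansion of Eu is
    rewritten as a bound on the initial vector. *)
Lemma hyperbolic_singularity_splitting : exists (Es Eu : {vspace 'rV[R]_n}) (K l : R),
  [/\ [/\ 0 < K, 0 < l & (Es + Eu)%VS = fullv], (Es :&: Eu = 0)%VS,
      forall t v, (v \in Es -> D t v \in Es) /\ (v \in Eu -> D t v \in Eu),
      forall t v, 0 <= t -> v \in Es -> N (D t v) <= K * expR (- (l * t)) * N v &
      forall t v, 0 <= t -> v \in Eu -> N v <= K * expR (- (l * t)) * N (D t v)].
Proof.
have [_ _ [Es [EX [Eu [K [l [_ [iS _ iU] full [K0 l0] [con eX ex]]]]]]]] := hyp.
exists (Es s), (Eu s), K, l.
have ss : [set s] s by [].
have [f d] := full s ss.
have EX0 : EX s = 0%VS.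
  by rewrite eX// Xs; apply/eqP; rewrite -dimv_eq0 dim_vline eqxx.
move: d; rewrite directv_addE /= => /and3P[_ _ /eqP d].
rewrite EX0 addv0 in f d.
split => //.
- move=> t v; rewrite /D; split => vE.
    by have := flow_invariant_mem t iS ss vE; rewrite fixs.
  by have := flow_invariant_mem t iU ss vE; rewrite fixs.
- by move=> t v t0 vE; have := con s v t ss vE t0; rewrite fixs.
move=> t v t0 vE; have := ex s v t ss vE t0; rewrite fixs.
rewrite -mulrA ler_pdivrMl// -(@ler_pM2r _ (expR (- (l * t)))) ?expR_gt0//.
by rewrite mulrAC -expRD subrr expR0 mul1r mulrAC.
Qed.

Lemma eigenvector_components (Es Eu : {vspace 'rV[R]_n}) t a u z :
  (Es :&: Eu = 0)%VS ->
  (forall t v, (v \in Es -> D t v \in Es) /\ (v \in Eu -> D t v \in Eu)) ->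
  u \in Es -> z \in Eu -> D t (u + z) = a *: (u + z) ->
  D t u = a *: u /\ D t z = a *: z.
Proof.
move=> EsEu iD uE zE E.
have E2 : D t u - a *: u = a *: z - D t z.
  apply/eqP; rewrite subr_eq addrAC eq_sym subr_eq eq_sym addrC -/(D t u).
  by move/eqP: E; rewrite /D linearD scalerDr [X in _ == X]addrC [X in X == _]addrC.
have h1 : D t u - a *: u \in Es by rewrite memvB ?memvZ//; exact: (iD t u).1.
have h2 : D t u - a *: u \in Eu.
  by rewrite E2 memvB ?memvZ//; exact: (iD t z).2.
have : D t u - a *: u \in (Es :&: Eu)%VS by rewrite memv_cap h1.
rewrite EsEu memv0 => /eqP h0; split; first by apply/eqP; rewrite -subr_eq0 h0.
by apply/eqP; rewrite eq_sym -subr_eq0 -E2 h0.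
Qed.

(** Both components of a fixed vector are fixed, also by the multiples of tau,
    against contraction and expansion. *)
Lemma hyperbolic_no_fixed_vector tau v : 0 < tau -> D tau v = v -> v = 0.
Proof.
move=> t0 Dv.
have [Es [Eu [K [l [[K0 l0 full] cap iD con ex]]]]] := hyperbolic_singularity_splitting.
have [u [z [uE zE vE]]] := split_vec v full.
have [|Du Dz] := @eigenvector_components Es Eu tau 1 u z cap iD uE zE.
  by rewrite -vE scale1r.
rewrite scale1r in Du; rewrite scale1r in Dz.
have it w (k : nat) : D tau w = w -> D (k%:R * tau) w = w.
  move=> Dw; elim: k => [|k IH]; first by rewrite mul0r /D (tflow_tmap0 tf).
  by rewrite mulrSr mulrDl mul1r singular_tmapD Dw IH.
have kt (k : nat) : 0 <= k%:R * tau by rewrite mulr_ge0// ltW.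
have u0 : u = 0.
  apply: (@tnorm_le0 _ _ _ g s).
  apply: (@expR_decay_nat_le0 _ _ (K * N u) l tau) => // [|k].
    by rewrite mulr_ge0 ?tnorm_ge0// ltW.
  by have := con _ u (kt k) uE; rewrite it// mulrAC.
have z0 : z = 0.
  apply: (@tnorm_le0 _ _ _ g s).
  apply: (@expR_decay_nat_le0 _ _ (K * N z) l tau) => // [|k].
    by rewrite mulr_ge0 ?tnorm_ge0// ltW.
  by have := ex _ z (kt k) zE; rewrite it// mulrAC.
by rewrite vE u0 z0 addr0.
Qed.

(** The components of w in Es and Eu are eigenvectors for the same eigenvalues
    as w. So the eigenvalues are small at large positive times if the stable
    component is nonzero, and otherwise at large negative times. *)
Lemma hyperbolic_invariant_line w : w != 0 -> (forall t, exists a, D t w = a *: w) ->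
  forall eta, 0 < eta -> exists2 t, 0 < t & exists2 a, `|a| <= eta &
    D t w = a *: w \/ D (- t) w = a *: w.
Proof.
move=> w0 ew eta eta0.
have [Es [Eu [K [l [[K0 l0 full] cap iD con ex]]]]] := hyperbolic_singularity_splitting.
have [u [z [uE zE wE]]] := split_vec w full.
have [t t0 ht] := expR_decay_small K l0 eta0.
exists t => //; have [a Dw] := ew t.
have [|Du Dz] := @eigenvector_components Es Eu t a u z cap iD uE zE; first by rewrite -wE.
have [u0|u0] := eqVneq u 0; last first.
  exists a; last by left.
  have := con t u (ltW t0) uE; rewrite Du /N tnormZ ler_pM2r ?tnorm_gt0//.
  by move=> /le_trans; apply; exact: ltW.
have zw : z = w by rewrite wE u0 add0r.
rewrite zw in zE Dz.
have := ex t w (ltW t0) zE; rewrite Dz /N tnormZ => h.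
have a0 : a != 0.
  apply/eqP => a0; move: h; rewrite a0 normr0 mul0r mulr0 => h.
  by move: w0; rewrite (tnorm_le0 h) eqxx.
exists a^-1.
  rewrite mulrA -[leLHS]mul1r ler_pM2r ?tnorm_gt0// in h.
  rewrite normfV -(ler_pM2r (_ : 0 < `|a|)) ?normr_gt0// mulVf ?normr_eq0//.
  by apply: le_trans h _; rewrite ler_wpM2r// ltW.
right; have : D (- t) (D t w) = w by rewrite -singular_tmapD addNr /D (tflow_tmap0 tf).
by rewrite Dw /D linearZ => {2}<-; rewrite scalerA mulVf// scale1r.
Qed.

End HyperbolicSingularity.

(** * Singularities in the intersection attract or repel *)

Section Singularities.
Context {R : realType} {n : nat} (M : manifold R n) (g : riemannian M).
Variables (X : M -> 'rV[R]_n) (phi : R -> M -> M) (Lp Lm : set M).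
Variables (E1 F1 E2 F2 : M -> {vspace 'rV[R]_n}) (C : R).
Hypotheses (phi_flow : is_flow X phi) (X1 : C1_field X).
Hypothesis XC : forall p, tnorm g p (X p) <= C.
Hypotheses (invp : Defs.invariant phi Lp) (invm : Defs.invariant (rev_flow phi) Lm).
Hypothesis s1 : sectional_hyperbolic_splitting g phi Lp E1 F1.
Hypothesis s2 : sectional_hyperbolic_splitting g (rev_flow phi) Lm E2 F2.
Variable s : M.
Hypotheses (Lps : Lp s) (Lms : Lm s) (Xs : X s = 0).
Hypothesis hyp : hyperbolic g X phi [set s].

Let tf : tangent_flow X phi := flow_tangent_flow phi_flow.
Let L := Lp `&` Lm.
Let c := chart_at s.
Let h := chart_disp c s.
Let V := (F1 s :&: F2 s)%VS.

Lemma singular_fixed t : phi t s = s.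
Proof. by have [_ inv _] := hyp; have := invariant_flow t inv (erefl s). Qed.

Lemma inter_invariant t x : L x -> L (phi t x).
Proof.
move=> [Lpx Lmx]; split; first exact: invariant_flow invp Lpx.
exact: (rev_invariant_forward invm t Lmx).
Qed.

(** By [sectional_line] the space V is at most a line, and it is invariant
    under the derivatives of the flow at s. *)
Lemma center_line_contracted : exists2 t, 0 < t &
  (forall l, l \in V -> `|tmap (phi t) s l| <= 8^-1 * `|l|) \/
  (forall l, l \in V -> `|tmap (phi (- t)) s l| <= 8^-1 * `|l|).
Proof.
have fixs := singular_fixed.
have [[w [wV w0]]|V0] := pselect (exists w, w \in V /\ w != 0); last first.
  exists 1 => //; left => l lV; have [->|l0] := eqVneq l 0.
    by rewrite linear0 normr0 mulr0.
  by exfalso; apply: V0; exists l.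
have line l : l \in V -> exists b, l = b *: w.
  move: wV; rewrite !memv_cap => /andP[w1 w2] /andP[l1 l2].
  exact: (sectional_line tf invm s1 s2 Lps Lms).
have ew t : exists a, tmap (phi t) s w = a *: w.
  have [[[_ [_ i1] _ _] _] _] := s1; have [[[_ [_ i2] _ _] _] _] := s2.
  apply: line; move: wV; rewrite !memv_cap => /andP[w1 w2]; apply/andP; split.
    by have := flow_invariant_mem t i1 Lps w1; rewrite fixs.
  by have := rev_bundle_forward t i2 Lms w2; rewrite fixs.
have e8 : 0 < 8^-1 :> R by rewrite invr_gt0.
have [t t0 [a a8 Dw]] := hyperbolic_invariant_line tf Xs fixs hyp w0 ew e8.
exists t => //; case: Dw => Dw; [left|right] => l /line[b ->].
  by rewrite linearZ /= Dw scalerA mulrC -scalerA normrZ ler_wpM2r.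
by rewrite linearZ /= Dw scalerA mulrC -scalerA normrZ ler_wpM2r.
Qed.

(** The map f collects the equations of F1 s and F2 s, evaluated at (D - 1) v.
    It is small at h p by [disp_annihilator]; its kernel is contained in V
    because D - 1 is injective and preserves F1 s and F2 s. *)
Lemma disp_close_to_center eps : 0 < eps ->
  \forall p \near s, L p -> exists2 l, l \in V & `|h p - l| <= eps * `|h p|.
Proof.
move=> eps0; have fixs := singular_fixed.
have [tau t0 st] := small_time phi_flow X1 Xs fixs.
have [[[[_ sF1] [_ i1] _ _] _] _] := s1; have [[[[_ sF2] [_ i2] _ _] _] _] := s2.
have [q1 q1V] := vspace_annihilator (F1 s); have [q2 q2V] := vspace_annihilator (F2 s).
pose B v := tmap (phi tau) s v - v.
have h1 e : 0 < e -> \forall p \near s, L p -> `|q1 (B (h p))| <= e * `|h p|.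
  move=> e0; apply: (disp_annihilator phi_flow X1 Xs fixs inter_invariant t0 st _ e0) => e' e'0.
  have := subbundle_near sF1 Lps (fun v => (q1V v).2) e'0.
  by apply: filterS => p hp [Lpp Lmp]; apply: hp => //; exact: (field_in_sectional_forward tf XC invp s1).
have h2 e : 0 < e -> \forall p \near s, L p -> `|q2 (B (h p))| <= e * `|h p|.
  move=> e0; apply: (disp_annihilator phi_flow X1 Xs fixs inter_invariant t0 st _ e0) => e' e'0.
  have := subbundle_near sF2 Lms (fun v => (q2V v).2) e'0.
  by apply: filterS => p hp [Lpp Lmp]; apply: hp => //; exact: (field_in_sectional_backward tf XC invm s2).
have Bl : linear B.
  by move=> a u v; rewrite /B linearP scalerBr opprD !addrA; congr (_ + _); rewrite addrAC.
pose f v : 'rV[R]_(n + n) := row_mx (q1 (B v)) (q2 (B v)).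
have fl : linear f.
  by move=> a u v; rewrite /f Bl !linearP scale_row_mx add_row_mx.
pose fL : {linear 'rV[R]_n -> 'rV[R]_(n + n)} :=
  HB.pack f (GRing.isLinear.Build R 'rV[R]_n 'rV[R]_(n + n) *:%R f fl).
pose BL : {linear 'rV[R]_n -> 'rV[R]_n} :=
  HB.pack B (GRing.isLinear.Build R 'rV[R]_n 'rV[R]_n *:%R B Bl).
have BE v : linfun BL v = B v by rewrite lfunE.
have kB : lker (linfun BL) = 0%VS.
  apply/eqP; rewrite -subv0; apply/subvP => v; rewrite memv_ker BE memv0 /B subr_eq0 => /eqP Dv.
  by apply/eqP; exact: (hyperbolic_no_fixed_vector tf Xs fixs hyp t0 Dv).
have pre (F : M -> {vspace 'rV[R]_n}) v : (forall u, u \in F s -> tmap (phi tau) s u \in F s) ->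
    B v \in F s -> v \in F s.
  move=> Fi; rewrite -BE; apply: injective_preimage_mem => //.
  apply/subvP => _ /memv_imgP[u uF ->]; rewrite BE memvB//; exact: Fi.
have [K K0 hK] := pseudo_inverse_bound (linfun fL).
pose e1 := eps / (2 * K); have e10 : 0 < e1 by rewrite divr_gt0// mulr_gt0.
apply: filterS2 (h1 e1 e10) (h2 e1 e10) => p hp1 hp2 Lp0.
have [l lk hl] := hK (h p); exists l.
  move: lk; rewrite memv_ker lfunE /= => /eqP; rewrite /f -[0 in RHS]row_mx0 => /eq_row_mx[/q1V b1 /q2V b2].
  rewrite memv_cap; apply/andP; split.
    apply: (pre F1) b1 => u uF.
    by have := flow_invariant_mem tau i1 Lps uF; rewrite fixs.
  apply: (pre F2) b2 => u uF.
  by have := rev_bundle_forward tau i2 Lms uF; rewrite fixs.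
apply: le_trans hl _; rewrite lfunE /=.
have := row_mx_norm_le (q1 (B (h p))) (q2 (B (h p))).
have := hp1 Lp0; have := hp2 Lp0; rewrite -/(f (h p)) => a1 a2 a3.
have : K * `|f (h p)| <= K * (e1 * `|h p| + e1 * `|h p|).
  by rewrite ler_pM2l//; apply: le_trans a3 _; rewrite lerD.
move=> /le_trans; apply.
by rewrite le_eqVlt; apply/orP; left; apply/eqP; rewrite /e1; field; rewrite gt_eqF.
Qed.

(** The derivative at s shrinks the V-part of the position by a factor 8, and
    everything else is of higher order. *)
Lemma center_contraction t :
  (forall l, l \in V -> `|tmap (phi t) s l| <= 8^-1 * `|l|) ->
  \forall p \near s, L p -> `|h (phi t p)| <= 2^-1 * `|h p|.
Proof.
move=> con; have fixs := singular_fixed.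
have [k k0 hk] := linear_rV_bound (tmap (phi t) s).
have e8 : 0 < 8^-1 :> R by rewrite invr_gt0.
(* Bounds the part of the position off V by an eighth both before and after
   applying the derivative; the total factor is then less than a half. *)
pose e1 := (8 * (1 + k))^-1.
have e10 : 0 < e1 by rewrite invr_gt0 mulr_gt0// addr_gt0.
apply: filterS2 (disp_linear phi_flow fixs t e8) (disp_close_to_center e10) => p h1 h2 Lp0.
have [l lV hl] := h2 Lp0.
have ke : k * e1 <= 8^-1 /\ e1 <= 8^-1.
  have E : e1 * (1 + k) = 8^-1 by rewrite /e1; field; rewrite !gt_eqF// addr_gt0.
  by split; nra.
have b1 : `|l| <= `|h p| + e1 * `|h p|.
  have := ler_normB (h p) (h p - l); rewrite subKr => /le_trans; apply.
  by rewrite lerD2l.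
have b2 : `|tmap (phi t) s (h p - l)| <= k * (e1 * `|h p|).
  by apply: le_trans (hk _) _; rewrite ler_pM2l.
have b3 := con l lV.
have b4 : `|tmap (phi t) s (h p)| <= `|tmap (phi t) s (h p - l)| + `|tmap (phi t) s l|.
  by rewrite -{1}(subrK l (h p)) linearD ler_normD.
have b5 : `|h (phi t p)| <= `|h (phi t p) - tmap (phi t) s (h p)| + `|tmap (phi t) s (h p)|.
  by rewrite -{1}(subrK (tmap (phi t) s (h p)) (h (phi t p))) ler_normD.
have b6 : k * e1 * `|h p| <= 8^-1 * `|h p| by rewrite ler_wpM2r//; exact: ke.1.
have b7 : e1 * `|h p| <= 8^-1 * `|h p| by rewrite ler_wpM2r//; exact: ke.2.
rewrite mulrA in b2; have := normr_ge0 (h p).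
move: h1 b1 b2 b3 b4 b5 b6 b7; lra.
Qed.

Lemma singularity_attracts : attracts phi L s \/ attracts (backward phi) L s.
Proof.
have cs : dom c s := chart_at_dom s.
have fa := is_flow_action phi_flow.
have fixs := singular_fixed.
have [t t0 [con|con]] := center_line_contracted; [left|right].
  exact: (contraction_attracts cs fa inter_invariant fixs t0 (center_contraction con)).
apply: (contraction_attracts cs (action_backward fa) _ _ t0 (center_contraction con)).
  by move=> u x; exact: inter_invariant.
by move=> u; exact: fixs.
Qed.

End Singularities.

(** * The decomposition *)

Section RegularHyperbolic.
Context {R : realType} {n : nat} (M : manifold R n) (g : riemannian M).
Variables (X : M -> 'rV[R]_n) (phi : R -> M -> M).

Lemma subbundle_sub (A B : set M) (E : M -> {vspace 'rV[R]_n}) :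
  A `<=` B -> subbundle B E -> subbundle A E.
Proof.
move=> AB sE x Ax; have [U [d [e [xU ec eb]]]] := sE x (AB _ Ax).
exists U, d, e; split => // [i k ak|y Ay]; last by apply: eb; exact: AB.
by apply: continuous_subspaceW (ec i k ak) => y [[/AB]].
Qed.

(** The field itself is a frame wherever it does not vanish. *)
Lemma field_line_subbundle (A : set M) : C1_field X -> A `&` sing X = set0 ->
  subbundle A (fun x => <[X x]>%VS).
Proof.
move=> X1 AX x Ax; exists setT, 1%N, (fun _ => X); split.
- exact: filterT.
- move=> _ k ak; apply/subspace_continuousP => y [_ cy].
  apply: cvg_trans (field_cvg X1 ak cy).
  exact: cvg_app (cvg_within _).
move=> y Ay _; have Xy : X y != 0.
  apply/eqP => Xy; have : (A `&` sing X) y by split.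
  by rewrite AX.
have -> : [tuple X y | _ < 1] = [tuple X y].
  by apply: eq_from_tnth => i; rewrite tnth_mktuple (tnth_nth 0) ord1.
exact: seq1_basis.
Qed.

Lemma contracting_with_mono (A B : set M) E K K' l l' : A `<=` B ->
  0 < K -> K <= K' -> l' <= l ->
  contracting_with g phi B E K l -> contracting_with g phi A E K' l'.
Proof.
move=> AB K0 KK ll con x v t Ax vE t0; apply: le_trans (con x v t (AB _ Ax) vE t0) _.
rewrite ler_wpM2r ?tnorm_ge0// ler_pM ?expR_ge0 ?(ltW K0)//.
by rewrite ler_expR lerN2 ler_wpM2r.
Qed.

Lemma expanding_with_mono (A B : set M) E K K' l l' : A `<=` B ->
  0 < K -> K <= K' -> l' <= l ->
  expanding_with g phi B E K l -> expanding_with g phi A E K' l'.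
Proof.
move=> AB K0 KK ll ex x v t Ax vE t0; apply: le_trans (ex x v t (AB _ Ax) vE t0).
have K'0 : 0 < K' by exact: lt_le_trans KK.
rewrite ler_wpM2r ?tnorm_ge0// ler_pM ?expR_ge0 ?invr_ge0 ?(ltW K'0)//.
  by rewrite lef_pV2 ?posrE.
by rewrite ler_expR ler_wpM2r.
Qed.

Lemma hyperbolic_regular_part (Lp Lm H : set M) (E1 F1 E2 F2 : M -> {vspace 'rV[R]_n}) C :
  tangent_flow X phi -> C1_field X -> (forall p, tnorm g p (X p) <= C) ->
  Defs.invariant phi Lp -> Defs.invariant (rev_flow phi) Lm ->
  sectional_hyperbolic_splitting g phi Lp E1 F1 ->
  sectional_hyperbolic_splitting g (rev_flow phi) Lm E2 F2 ->
  compact H -> Defs.invariant phi H -> H `<=` Lp `&` Lm -> H `&` sing X = set0 ->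
  hyperbolic g X phi H.
Proof.
move=> tf X1 XC invp invm s1 s2 cH invH HL HX; split => //.
have HLp : H `<=` Lp by move=> x /HL[].
have HLm : H `<=` Lm by move=> x /HL[].
have [[[[sE1 _] [iE1 _] _ _] [K1 [l1 [K10 l10 con]]]] _] := s1.
have [[[[sE2 _] [iE2 _] _ _] _] _] := s2.
have [K2 [l2 [K20 l20 ex]]] := rev_contracting_expanding tf invm s2.
exists E1, (fun x => <[X x]>%VS), E2, (Num.max K1 K2), (Num.min l1 l2); split.
- split; [exact: subbundle_sub sE1|exact: field_line_subbundle|exact: subbundle_sub sE2].
- split => t x Hx; first by apply: iE1; exact: HLp.
    by rewrite limg_line lfunE /= (tflow_field tf).
  by have := iE2 (- t) x (HLm _ Hx); rewrite /rev_flow opprK.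
- move=> x Hx; have Xx : X x != 0.
    apply/eqP => Xx; have : (H `&` sing X) x by split.
    by rewrite HX.
  exact: (regular_splitting tf XC invp invm s1 s2 (HLp _ Hx) (HLm _ Hx) Xx).
- by rewrite lt_max K10 lt_min l10.
split => //.
  by apply: contracting_with_mono con => //; rewrite ?le_max ?ge_min lexx ?orbT.
by apply: expanding_with_mono ex => //; rewrite ?le_max ?ge_min lexx ?orbT.
Qed.

Lemma regular_nbhs x : C1_field X -> X x != 0 -> nbhs x (~` sing X).
Proof.
move=> X1 Xx; set k := chart_at x.
have ak : atlas k := chart_at_atlas x; have kx : dom k x := chart_at_dom x.
have := field_cvg X1 ak kx; have -> : tcoord k x (X x) = X x by exact: tcoord_chart_at.
move=> /cvgrPdist_lt /(_ `|X x|); rewrite normr_gt0 => /(_ Xx).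
apply: filterS => y; rewrite /sing /= => hy Xy; move: hy.
by rewrite Xy linear0 subr0 ltxx.
Qed.

End RegularHyperbolic.

Theorem corollary2p5 (R : realType) (n : nat) (M : manifold R n)
    (g : riemannian M) (X : M -> 'rV[R]_n) (phi : R -> M -> M)
    (Lp Lm : set M)
    (M_compact : compact [set: M])
    (X_C1 : C1_field X)
    (phi_flow : is_flow X phi)
    (Lp_pos : positively_sectional_hyperbolic g X phi Lp)
    (Lm_neg : negatively_sectional_hyperbolic g X phi Lm) :
  exists H S Reg : set M,
    [/\ Lp `&` Lm = H `|` S `|` Reg,
        [/\ H `&` S = set0, H `&` Reg = set0 & S `&` Reg = set0],
        hyperbolic g X phi H /\ H `&` sing X = set0,
        finite_set S /\ S `<=` sing X &
        Reg `&` sing X = set0 /\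
        forall x, Reg x ->
          alpha_limit phi x `<=` H `|` S /\ omega_limit phi x `<=` H `|` S].
Proof.
have hM : hausdorff_space M := @mhausdorff _ _ M.
have [cLp invp hypp [E1 [F1 s1]]] := Lp_pos.
have [cLm invm _ [E2 [F2 s2]]] := Lm_neg.
have tf := flow_tangent_flow phi_flow.
have [C _ XC] := speed_bounded g M_compact X_C1.
have fa := is_flow_action phi_flow; have fab := action_backward fa.
pose L := Lp `&` Lm.
have invL t x : L x -> L (phi t x) by exact: (inter_invariant invp invm).
have invLb t x : L x -> L (backward phi t x) by exact: invL.
have clLp : closed Lp by exact: compact_closed.
have clLm : closed Lm by exact: compact_closed.
have clL : closed L by exact: closedI.
have cL : compact L.
  by apply: subclosed_compact clL cLp _ => x [].
pose S := L `&` sing X.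
have SL : S `<=` L by move=> x [].
have fixS s t : S s -> phi t s = s.
  by move=> [[Ls _] Xs]; apply: (singular_fixed (hypp s Ls Xs)).
have AS s : S s -> attracts phi L s \/ attracts (backward phi) L s.
  move=> [[Lps Lms] Xs].
  exact: (singularity_attracts phi_flow X_C1 XC invp invm s1 s2 Lps Lms Xs (hypp s Lps Xs)).
have ASb s : S s -> attracts (backward phi) L s \/ attracts (backward (backward phi)) L s.
  by rewrite backwardK => /AS [|]; [right|left].
pose H := remainder phi L S.
have HL : H `<=` L by move=> x [].
have HS : H `&` S = set0 by exact: remainder_disjoint.
have HX : H `&` sing X = set0.
  rewrite -subset0 => x [Hx Xx].
  by rewrite -HS; split => //; split => //; exact: HL.
exists H, S, (L `\` (H `|` S)); split.
- apply/seteqP; split => [x Lx|x].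
    by have [?|?] := pselect ((H `|` S) x); [left|right].
  by case=> [[/HL|/SL]|[]].
- split => //; apply/seteqP; split => // x [hx [_ nhx]]; apply: nhx; by [left|right].
- split => //; apply: (hyperbolic_regular_part tf X_C1 XC invp invm s1 s2) => //.
    apply: subclosed_compact cL HL; exact: (remainder_closed fa invL clL).
  apply: (flow_closed_invariant tf) => t x; exact: (remainder_invariant fa invL).
- split; last by move=> x [].
  apply: (locally_finite_compact cL SL) => x Lx.
  have [Xx|Xx] := eqVneq (X x) 0; first exact: (attracted_isolated hM SL fixS AS).
  exists (~` sing X); first exact: regular_nbhs.
  suff -> : S `&` ~` sing X = set0 by exact: finite_set0.
  by rewrite -subset0 => y [[_ Xy] /(_ Xy)].
split.
  rewrite -subset0 => x [[Lx nx] Xx]; apply: nx; right; split => //.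
move=> x [Lx nHS]; have nSx : ~ S x by move=> Sx; apply: nHS; right.
split; last exact: (omega_remainder hM fa invL clL).
rewrite /H -remainder_backward.
exact: (omega_remainder hM fab invLb clL).
Qed.
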